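(* Let $G$ be a noncomplete decomposable graph and let $P=(C_1,\dots,C_k)$ be a perfect order of its cliques. Then $A_P\subset\mathcal{A}$. More specifically, for $y\in P_G$ and $(\alpha,\beta)\in A_P$ the integral below converges and $$\int_{Q_G}e^{-\langle x,y\rangle}H_G(\alpha,\beta;x)\,\mu_G(dx)=\Gamma_{\mathrm I}(\alpha,\beta)\,H_G(\alpha,\beta;\varphi(y)),$$ where $$\Gamma_{\mathrm I}(\alpha,\beta)=\Gamma_{s_2}(\alpha_1+\delta_2)\,\frac{\Gamma_{c_1}(\alpha_1)}{\Gamma_{s_2}(\alpha_1)}\prod_{q=2}^k\frac{\Gamma_{c_q}(\alpha_q)}{\Gamma_{s_q}(\alpha_q)}.$$
   Context: **Graphs.** $G=(V,E)$ is an undirected graph with $V=\{1,\dots,r\}$; $E\subset V\times V$ is symmetric and contains all $(i,i)$. $G$ is decomposable if it is connected and has no induced cycle of length $\ge4$. A clique is a maximal complete subset of $V$; $\mathcal{C}$ is the set of cliques. A perfect order of the cliques is an order $P=(C_1,\dots,C_k)$ such that, with $S_j=(C_1\cup\dots\cup C_{j-1})\cap C_j$, for each $j\ge2$ there is $i<j$ with $S_j\subset C_i$. The sets $S_2,\dots,S_k$ are the minimal separators; $\mathcal{S}$ is the set of distinct ones and $\nu(S)$, the number of $j$ with $S_j=S$, does not depend on the perfect order. **Cones.** $I_G$ is the real space of functions $x:E\to\mathbb{R}$ with $x_{ij}=x_{ji}$; $Z_G$ is the space of symmetric $r\times r$ matrices $y$ with $y_{ij}=0$ for $(i,j)\notin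 E$. $P_G=\{y\in Z_G: y \text{ positive definite}\}$; $Q_G=\{x\in I_G: x_C \text{ positive definite for every clique } C\}$, where $x_C=(x_{ij})_{i,j\in C}$. For $x\in Q_G$ there is a unique positive definite $\hat x$ with $\hat x_{ij}=x_{ij}$ for $(i,j)\in E$ and $\hat x^{-1}\in P_G$; $x\mapsto\hat x^{-1}$ is a bijection $Q_G\to P_G$ with inverse $\varphi$ ($\varphi(y)$ is the restriction of $y^{-1}$ to the entries in $E$). $\langle x,y\rangle=\sum_{(i,j)\in E}x_{ij}y_{ij}$. $dx=\prod_{i\le j,(i,j)\in E}dx_{ij}$. $|\cdot|$ of a matrix is its determinant, of a set its cardinality. **Measures.** For $\alpha:\mathcal{C}\to\mathbb{R}$, $\beta:\mathcal{S}\to\mathbb{R}$, $x\in Q_G$: $H_G(\alpha,\beta;x)=\prod_{C\in\mathcal{C}}|x_C|^{\alpha(C)}\big/\prod_{S\in\mathcal{S}}|x_S|^{\nu(S)\beta(S)}$ and $\mu_G(dx)=\prod_{C\in\mathcal{C}}|x_C|^{-(|C|+1)/2}\prod_{S\in\mathcal{S}}|x_S|^{\nu(S)(|S|+1)/2}\,\mathbf 1_{Q_G}(x)\,dx$. $\mathcal{A}$ is the set of $(\alpha,\beta)$ such that $I(\alpha,\beta;y)=\int_{Q_G}e^{-\langle x,y\rangle}H_G(\alpha,\beta;x)\mu_G(dx)$ converges for all $y\in P_G$ and $y\mapsto I(\alpha,\beta;y)/H_G(\alpha,\beta;\varphi(y))$ is constant on $P_G$. $\Gamma_n(p)=\pi^{n(n-1)/4}\prod_{j=1}^n\Gamma(p-\frac{j-1}{2})$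 for $p>\frac{n-1}{2}$. **The set $A_P$.** Put $c_j=|C_j|$, $s_j=|S_j|$, $\alpha_j=\alpha(C_j)$, $\beta_j=\beta(S_j)$, $J(P,S)=\{j\in\{2,\dots,k\}:S_j=S\}$. $A_P$ is the set of $(\alpha,\beta)$ such that: (1) $\sum_{j\in J(P,S)}\alpha_j-\nu(S)\beta(S)=0$ for all $S\in\mathcal{S}$ with $S\ne S_2$; (2) $\alpha_j-\frac{c_j-1}{2}>0$ for all $j=1,\dots,k$; (3) $\alpha_1+\delta_2>\frac{s_2-1}{2}$, where $\delta_2=\sum_{j\in J(P,S_2)}\alpha_j-\nu(S_2)\beta_2$. *)

(* Defs.v *)
From HB Require Import structures.
From mathcomp Require Import all_boot all_order all_algebra.
From mathcomp Require Import all_classical all_reals all_analysis.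

Set Implicit Arguments.
Unset Strict Implicit.
Unset Printing Implicit Defensive.
Import Order.TTheory GRing.Theory Num.Theory.
Import numFieldNormedType.Exports.
Local Open Scope classical_set_scope.
Local Open Scope ring_scope.

(** * Lebesgue measure on R^n, with points represented by n-tuples *)

Section leb_cons.
Context (R : realType) (n : nat).
Variable m : {sigma_finite_measure set (n.-tuple (measurableTypeR R)) -> \bar R}.

Definition tcons (p : measurableTypeR R * n.-tuple (measurableTypeR R)) :
  n.+1.-tuple (measurableTypeR R) := [tuple of p.1 :: p.2].

Lemma measurable_tcons : measurable_fun setT tcons.
Proof. by apply: measurable_cons; [exact: measurable_fst|exact: measurable_snd]. Qed.

Definition leb_cons : set (n.+1.-tuple (measurableTypeR R)) -> \bar R :=
  pushforward (@lebesgue_measure R \x m)%E tcons.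

Let leb_cons0 : leb_cons set0 = 0%E.
Proof. by rewrite /leb_cons /pushforward preimage_set0 measure0. Qed.

Let leb_cons_ge0 A : (0 <= leb_cons A)%E.
Proof. by rewrite /leb_cons /pushforward; apply: measure_ge0. Qed.

Let leb_cons_sigma_additive : semi_sigma_additive leb_cons.
Proof.
move=> F mF tF mUF; rewrite /leb_cons /pushforward preimage_bigcup.
have mp B : measurable B -> measurable (tcons @^-1` B).
  by move=> mB; rewrite -[X in measurable X]setTI; exact: measurable_tcons.
apply: measure_semi_sigma_additive.
- by move=> i; exact: mp.
- apply/trivIsetP => /= i j _ _ ij; rewrite -preimage_setI.
  by move/trivIsetP : tF => /(_ _ _ _ _ ij) ->//; rewrite preimage_set0.
- by rewrite -preimage_bigcup; exact: mp.
Qed.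

HB.instance Definition _ := isMeasure.Build _ _ _
  leb_cons leb_cons0 leb_cons_ge0 leb_cons_sigma_additive.

Let leb_cons_sigma_finite : sigma_finite setT leb_cons.
Proof.
have /sigma_finiteP[F [FT ndF Foo]] := sigma_finiteT (@lebesgue_measure R).
have /sigma_finiteP[G [GT ndG Goo]] := sigma_finiteT m.
pose g0 (t : n.+1.-tuple (measurableTypeR R)) : measurableTypeR R :=
  tnth t ord0.
pose g1 (t : n.+1.-tuple (measurableTypeR R)) :
  n.-tuple (measurableTypeR R) := [tuple of behead t].
exists (fun i => g0 @^-1` F i `&` g1 @^-1` G i).
  apply/seteqP; split => // t _.
  have [i _ Fi] : (\bigcup_i F i) (g0 t) by rewrite -FT.
  have [j _ Gj] : (\bigcup_i G i) (g1 t) by rewrite -GT.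
  exists (maxn i j) => //; split.
  - by have /subsetPset := ndF _ _ (leq_maxl i j); apply.
  - by have /subsetPset := ndG _ _ (leq_maxr i j); apply.
move=> i; have [mFi fFi] := Foo i; have [mGi fGi] := Goo i; split.
  apply: measurableI; rewrite -[X in measurable X]setTI.
  - exact: (@measurable_tnth _ (measurableTypeR R) n.+1 ord0).
  - exact: (@measurable_behead _ (measurableTypeR R) n).
rewrite /leb_cons /pushforward (_ : _ @^-1` _ = F i `*` G i).
  by rewrite product_measure1E// lte_mul_pinfty// ge0_fin_numE.
apply/seteqP; split=> -[a b] /= [Fa Gb]; split=> //.
- by move: Gb; rewrite /g1 /= (_ : [tuple of _] = b)//; exact/val_inj.
- by rewrite /g1 /= (_ : [tuple of _] = b)//; exact/val_inj.
Qed.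

HB.instance Definition _ := Measure_isSigmaFinite.Build _ _ _
  leb_cons leb_cons_sigma_finite.

End leb_cons.

Fixpoint lebesgue_tuple (R : realType) (n : nat) :
    {sigma_finite_measure set (n.-tuple (measurableTypeR R)) -> \bar R} :=
  match n with
  | 0 => \d_([tuple] : 0.-tuple (measurableTypeR R))
  | n'.+1 => leb_cons (lebesgue_tuple R n')
  end.

Lemma lebesgue_tuple_box (R : realType) (n : nat)
    (A : 'I_n -> set (measurableTypeR R)) :
  (forall i, measurable (A i)) ->
  lebesgue_tuple R n [set t | forall i, A i (tnth t i)] =
  (\prod_(i < n) lebesgue_measure (A i))%E.
Proof.
elim: n A => [|n IH] A mA.
  by rewrite big_ord0 /= diracE mem_set// => -[].
rewrite big_ord_recl -IH; last by move=> i; exact: mA.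
rewrite /= /leb_cons /pushforward -product_measure1E//; last first.
  rewrite (_ : [set t | _] = \bigcap_(i in [set: 'I_n])
      ((@tnth _ (measurableTypeR R)) ^~ i @^-1` A (lift ord0 i))).
    apply: fin_bigcap_measurable => // i _.
    by rewrite -[X in measurable X]setTI; apply: measurable_tnth.
  by apply/seteqP; split=> t /= h i => [_|]; exact: h.
congr ((_ \x _)%E _); apply/seteqP; split=> -[a t] /=.
  move=> h; split; first by have := h ord0.
  by move=> i; have := h (lift ord0 i); rewrite tnthS.
move=> [h0 h] i; case: (unliftP ord0 i) => [j ->|-> //].
by rewrite tnthS; exact: h.
Qed.

(** * Decomposable graphs *)

Section graphs.
Variables (r : nat) (e : rel 'I_r).

(** [next s x] is the successor of [x] in the cyclic sequence [s]; as [e] is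
    reflexive, [x == y] is among the allowed adjacencies. *)
Definition induced_cycle (s : seq 'I_r) : Prop :=
  uniq s /\ {in s &, forall x y,
    e x y = [|| x == y, y == next s x | x == next s y]}.

Definition decomposable : Prop :=
  (forall x y, connect e x y) /\
  (forall s : seq 'I_r, induced_cycle s -> (size s < 4)%N).

Definition complete (C : {set 'I_r}) : bool :=
  [forall i in C, forall j in C, e i j].

Definition cliques : {set {set 'I_r}} := [set C | maxset complete C].

(** Indices start at [0]: for the usual numbering [P = (C_1, ..., C_k)], [C_j]
    and [S_j] are [nth set0 P j.-1] and [separator P j.-1]; in particular [S_2]
    is [separator P 1]. *)
Definition separator (P : seq {set 'I_r}) (j : nat) : {set 'I_r} :=
  (\bigcup_(i < j) nth finset.set0 P i) :&: nth finset.set0 P j.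

Definition perfect_order (P : seq {set 'I_r}) : bool :=
  perm_eq P (enum cliques) &&
  [forall j : 'I_(size P), (0 < j)%N ==>
     [exists i : 'I_(size P), (i < j)%N &&
        (separator P j \subset nth finset.set0 P i)]].

(** The minimal separators and their multiplicities do not depend on the
    perfect order; they are read off an arbitrarily chosen one, so that they are
    attached to the graph. *)
Definition some_perfect_order : seq {set 'I_r} :=
  if [pick P : #|cliques|.-tuple {set 'I_r} | perfect_order P] is Some P
  then P : seq _ else [::].

Definition separator_seq (P : seq {set 'I_r}) : seq {set 'I_r} :=
  [seq separator P j | j <- iota 1 (size P).-1].

Definition separators : {set {set 'I_r}} :=
  [set S in separator_seq some_perfect_order].

Definition nu (S : {set 'I_r}) : nat :=
  count_mem S (separator_seq some_perfect_order).

End graphs.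

(** * Cones *)

Section cones.
Variables (R : realType) (r : nat) (e : rel 'I_r).

Definition posdefmx n (A : 'M[R]_n) : Prop :=
  A^T = A /\ forall v : 'cV[R]_n, v != 0 -> 0 < (v^T *m A *m v) ord0 ord0.

Definition restr (x : 'M[R]_r) (C : {set 'I_r}) : 'M[R]_#|C| :=
  mxsub (@enum_val _ (mem C)) (@enum_val _ (mem C)) x.

(** Both [Z_G] and [I_G]: a symmetric function on [E] is represented by its
    extension by [0] to a symmetric matrix. *)
Definition graphmx (x : 'M[R]_r) : Prop :=
  x^T = x /\ forall i j, ~~ e i j -> x i j = 0.

Definition PG (y : 'M[R]_r) : Prop := graphmx y /\ posdefmx y.

Definition QG (x : 'M[R]_r) : Prop :=
  graphmx x /\ forall C, C \in cliques e -> posdefmx (restr x C).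

Definition phi (y : 'M[R]_r) : 'M[R]_r :=
  \matrix_(i, j) (if e i j then invmx y i j else 0).

Definition pairing (x y : 'M[R]_r) : R :=
  \sum_(i < r) \sum_(j < r | e i j) x i j * y i j.

(** The coordinates [x_ij], [i <= j], [(i, j) \in E], of [I_G]. *)
Definition coords : {set 'I_r * 'I_r} :=
  [set p : 'I_r * 'I_r | (p.1 <= p.2)%N && e p.1 p.2].

Definition graphmx_of (t : #|coords|.-tuple (measurableTypeR R)) : 'M[R]_r :=
  \matrix_(i, j) (let p := if (i <= j)%N then (i, j) else (j, i) in
                  if p \in coords then nth 0 t (index p (enum coords)) else 0).

(** [int_QG f] is the integral of [f] over [Q_G] against [dx]. *)
Definition QG_coords : set (#|coords|.-tuple (measurableTypeR R)) :=
  [set t | QG (graphmx_of t)].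

Definition QG_integrable (f : 'M[R]_r -> R) : Prop :=
  (lebesgue_tuple R #|coords|).-integrable QG_coords
    (fun t => (f (graphmx_of t))%:E).

Definition int_QG (f : 'M[R]_r -> R) : R :=
  \int[lebesgue_tuple R #|coords|]_(t in QG_coords) f (graphmx_of t).

End cones.

(** * Markov ratios, gamma functions and the sets [A] ([calA]) and [A_P] *)

(** Functions on the set of cliques or of minimal separators are represented by
    functions on all vertex sets, whose other values are never used. *)

Section measures.
Variables (R : realType) (r : nat) (e : rel 'I_r).
Implicit Types (alpha beta : {set 'I_r} -> R) (P : seq {set 'I_r}).

Definition HG alpha beta (x : 'M[R]_r) : R :=
  (\prod_(C in cliques e) \det (restr x C) `^ alpha C) /
  (\prod_(S in separators e) \det (restr x S) `^ ((nu e S)%:R * beta S)).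

(** Density of [mu_G] with respect to [dx] on [Q_G]. *)
Definition muG (x : 'M[R]_r) : R :=
  (\prod_(C in cliques e) \det (restr x C) `^ (- (#|C|%:R + 1) / 2)) *
  (\prod_(S in separators e)
      \det (restr x S) `^ ((nu e S)%:R * (#|S|%:R + 1) / 2)).

Definition integrand alpha beta (y x : 'M[R]_r) : R :=
  expR (- pairing e x y) * HG alpha beta x * muG x.

Definition IG alpha beta (y : 'M[R]_r) : R :=
  int_QG e (integrand alpha beta y).

Definition calA : set (({set 'I_r} -> R) * ({set 'I_r} -> R)) :=
  [set ab | (forall y, PG e y -> QG_integrable e (integrand ab.1 ab.2 y)) /\
            exists c : R, forall y, PG e y ->
              IG ab.1 ab.2 y / HG ab.1 ab.2 (phi e y) = c].

Definition sum_J alpha P (S : {set 'I_r}) : R :=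
  \sum_(1 <= j < size P | separator P j == S) alpha (nth finset.set0 P j).

Definition delta2 alpha beta P : R :=
  sum_J alpha P (separator P 1) -
  (nu e (separator P 1))%:R * beta (separator P 1).

Definition A_P P : set (({set 'I_r} -> R) * ({set 'I_r} -> R)) :=
  [set ab | [/\
    forall S, S \in separators e -> S != separator P 1 ->
      sum_J ab.1 P S - (nu e S)%:R * ab.2 S = 0,
    forall C, C \in P -> 0 < ab.1 C - (#|C|%:R - 1) / 2 &
    (#|separator P 1|%:R - 1) / 2 <
      ab.1 (nth finset.set0 P 0) + delta2 ab.1 ab.2 P]].

Definition Gamma (p : R) : R :=
  \int[lebesgue_measure]_(t in `]0, +oo[) (t `^ (p - 1) * expR (- t)).

(** Multivariate gamma function, [\prod_(j = 1..n) Gamma (p - (j - 1) / 2)] with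
    [j] shifted to start at [0]. *)
Definition Gamma_mv (n : nat) (p : R) : R :=
  pi `^ (n%:R * (n%:R - 1) / 4) * \prod_(j < n) Gamma (p - j%:R / 2).

Definition Gamma_I alpha beta P : R :=
  let C q := nth finset.set0 P q in
  let S q := separator P q in
  Gamma_mv #|S 1| (alpha (C 0) + delta2 alpha beta P) *
  (Gamma_mv #|C 0| (alpha (C 0)) / Gamma_mv #|S 1| (alpha (C 0))) *
  \prod_(1 <= q < size P)
     (Gamma_mv #|C q| (alpha (C q)) / Gamma_mv #|S q| (alpha (C q))).

End measures.

(* Main.v *)
Require Import Defs.
From HB Require Import structures.
From mathcomp Require Import all_boot all_order all_algebra.
From mathcomp Require Import all_classical all_reals all_analysis.
From mathcomp Require Import measurable_realfun ring lra.
Set Implicit Arguments.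
Unset Strict Implicit.
Unset Printing Implicit Defensive.
Import Order.TTheory GRing.Theory Num.Theory.
Import numFieldNormedType.Exports.
Local Open Scope classical_set_scope.
Local Open Scope ring_scope.

(** The vertices are integrated out one at a time, along a perfect elimination
    order read off [P]: those of [S_2] first, then those of [C_1 \ S_2],
    [C_2 \ S_2], [C_3 \ S_3], and so on; the last vertex is eliminated first.
    Attach to a vertex [v] with earlier neighbours [N] (a complete set) the exponent
    [a] of its block: [alpha_1 + delta_2] for [S_2], and [alpha_j] for the part of
    [C_j] introduced by the [j]-th clique.  With [w = |x_{N + v}| / |x_N|],
    condition (1) of [A_P] says that [H_G] is the product of the [w ^ a] over all
    vertices, and the density of [mu_G] telescopes into factors
    [w ^ (- (|N| + 2) / 2) |x_N| ^ (- 1 / 2)].  As [w = x_vv - x_vN x_N^-1 x_Nv], the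
    integral over [x_vv] is a Gamma integral and the integral over [x_vN] is a
    Gaussian one; the result is
    [pi ^ (|N| / 2) Gamma (a - |N| / 2) y_vv ^ (- a)] times the integral of the graph
    without [v], with [y] replaced by its Schur complement.  The [y_vv ^ (- a)]
    multiply up to [H_G (phi y)], since [1 / y_vv] is the [w] of [y^-1].
    Only Tonelli's theorem and one-dimensional integrals are needed. *)

(** * Principal minors and Schur complements *)

(** The domain [Q_G] needs no separate treatment: a vertex factor is 0 unless its ratio w is
    positive, and positivity of all the ratios amounts to positive definiteness on every complete
    set. So the integral runs over the whole coordinate space. The integrand being nonnegative, the
    variables may be taken in any order, and convergence is read off from the finite value. The
    induction survives because N is complete: the Schur complement of y changes only entries indexed
    by N x N among those that remain, so nothing appears outside E. The special role of S_2 comes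
    from (1), which leaves one separator with a possible excess delta_2 of exponent; its vertices
    are put at the bottom of the list, where this excess joins alpha_1. Within a block the sets N
    grow up to size c_j - 1, or s_2 - 1 for S_2, so (2) and (3) are what makes every Gamma integral
    converge. Finally, nu and the separators are defined through an arbitrarily picked perfect
    order, so their independence of it has to be proved. *)

Lemma det1D_mulC (F : comNzRingType) m n (A : 'M[F]_(m, n)) (B : 'M[F]_(n, m)) :
  \det (1%:M + A *m B) = \det (1%:M + B *m A).
Proof.
(* Sylvester's identity: [X] has two block triangular factorisations, and each side is the
   determinant read off one of them. *)
pose X := block_mx 1%:M (- B) A (1%:M : 'M[F]_m).
have XE : X = block_mx 1%:M 0 A 1%:M *m block_mx 1%:M (- B) 0 (1%:M + A *m B).
  rewrite mulmx_block !mul1mx !mulmx1 !mul0mx !addr0 mulmxN.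
  by rewrite addrCA addNr addr0.
have XE' : X = block_mx (1%:M + B *m A) (- B) 0 1%:M *m block_mx 1%:M 0 A 1%:M.
  rewrite mulmx_block !mul0mx !mulmx1 !mulmx0 !mul1mx !add0r mulNmx.
  by rewrite addrK.
transitivity (\det X).
  by rewrite XE det_mulmx det_lblock det_ublock !det1 !mul1r.
by rewrite XE' det_mulmx det_lblock det_ublock !det1 !mulr1.
Qed.

Section minors.
Variables (R : realType) (r : nat).
Implicit Types (N M : {set 'I_r}) (x y : 'M[R]_r) (v : 'I_r).

(** Extends the block of [x] indexed by [N] by the identity, so that all principal
    minors become determinants of the same size. *)
Definition pad N x : 'M[R]_r :=
  \matrix_(i, j) if (i \in N) && (j \in N) then x i j else (i == j)%:R.

(** With [E] the 0-1 matrix selecting the rows of N, [pad N x] is 1 + E^T (x_N - 1) E. As E E^T = 1,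
    Sylvester's identity brings the determinant back to size |N|. *)
Lemma det_restr N x : \det (restr x N) = \det (pad N x).
Proof.
pose E : 'M[R]_(#|N|, r) := \matrix_(k, i) (enum_val k == i)%:R.
have EE : E *m E^T = 1%:M.
  apply/matrixP => k l; rewrite !mxE (bigD1 (enum_val k)) //= !mxE eqxx mul1r.
  rewrite big1 => [|i ik]; last by rewrite !mxE eq_sym (negPf ik) mul0r.
  by rewrite addr0 eq_sym (inj_eq enum_val_inj).
have sumE (f : 'I_#|N| -> R) i :
    \sum_k (enum_val k == i)%:R * f k =
    if i \in N then \sum_(k | enum_val k == i) f k else 0.
  case: ifP => iN; last first.
    rewrite big1 // => k _; case: eqP => [ki|_]; last by rewrite mul0r.
    by move: (enum_valP k); rewrite ki iN.
  rewrite [RHS]big_mkcond; apply: eq_bigr => k _.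
  by case: eqP => _; rewrite ?mul1r ?mul0r.
have padE : pad N x = 1%:M + E^T *m ((restr x N - 1%:M) *m E).
  apply/matrixP => i j; rewrite [LHS]mxE [RHS]mxE.
  rewrite [X in _ = _ + X]mxE.
  under [X in _ = _ + X]eq_bigr => k _ do rewrite mxE [E _ _]mxE.
  rewrite sumE mxE; case: ifP => [/andP[iN jN]|ij]; last first.
    case: ifP ij => iN /= jN; last by rewrite addr0.
    rewrite big1 ?addr0// => k _; rewrite mxE big1 // => l _.
    rewrite [E l j]mxE; case: eqP => [lj|_]; last by rewrite mulr0.
    by move: (enum_valP l); rewrite lj jN.
  rewrite iN (big_pred1 (enum_rank_in iN i)) => [|k]; last first.
    by rewrite /= -(inj_eq (@enum_val_inj _ (mem N))) enum_rankK_in.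
  rewrite mxE (bigD1 (enum_rank_in jN j)) //= big1 => [|l lj]; last first.
    rewrite [E _ _]mxE; case: eqP => [lj'|_]; last by rewrite mulr0.
    case/eqP: lj; apply: (@enum_val_inj _ (mem N)).
    by rewrite enum_rankK_in.
  rewrite !mxE !enum_rankK_in// eqxx mulr1 addr0.
  rewrite -(inj_eq (@enum_val_inj _ (mem N))) !enum_rankK_in//.
  by rewrite [RHS]addrC subrK.
by rewrite padE det1D_mulC -mulmxA EE mulmx1 [in RHS]addrC subrK.
Qed.

Lemma det_col_single (M : 'M[R]_r) v : (forall i, i != v -> M i v = 0) ->
  \det M = M v v * \det (row' v (col' v M)).
Proof.
move=> Mv; rewrite (expand_det_col _ v) (bigD1 v) //= big1 => [|i iv].
  by rewrite addr0 /cofactor addnn -signr_odd odd_double expr0 mul1r.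
by rewrite Mv ?mul0r.
Qed.

Lemma det_row_single (M : 'M[R]_r) v : (forall i, i != v -> M v i = 0) ->
  \det M = M v v * \det (row' v (col' v M)).
Proof.
move=> Mv; rewrite -det_tr (@det_col_single _ v) => [|i iv]; last first.
  by rewrite mxE Mv.
by rewrite mxE -det_tr; congr (_ * \det _); apply/matrixP => i j; rewrite !mxE.
Qed.

(** The vector [c] stands for x_N^-1 x_Nv, given by its linear system so that no inverse of varying
    size occurs. Subtracting from column v the columns of N weighted by [c] clears it off the
    diagonal. *)
Lemma det_restr_setU1 N x v (c : 'I_r -> R) : v \notin N ->
  (forall i, i \in N -> \sum_(j in N) x i j * c j = x i v) ->
  \det (restr x (v |: N)) =
  \det (restr x N) * (x v v - \sum_(j in N) x v j * c j).
Proof.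
move=> vN xc; rewrite !det_restr.
pose T : 'M[R]_r := \matrix_(i, j)
  ((i == j)%:R - if (j == v) && (i \in N) then c i else 0).
have detT : \det T = 1.
  rewrite (@det_row_single _ v) => [|i iv]; last first.
    by rewrite mxE (negPf vN) andbF subr0 eq_sym (negPf iv).
  rewrite mxE eqxx (negPf vN) subr0 mul1r.
  rewrite (_ : row' _ _ = 1%:M) ?det1//; apply/matrixP => i j; rewrite !mxE.
  by rewrite (inj_eq lift_inj) [lift v j == v]eq_sym (negPf (neq_lift v j)) subr0.
have AT i j : (pad (v |: N) x *m T) i j = pad (v |: N) x i j -
    if j == v then \sum_(k in N) pad (v |: N) x i k * c k else 0.
  rewrite mxE; under eq_bigr do rewrite [T _ _]mxE mulrBr; rewrite sumrB;
    congr (_ - _).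
    rewrite (bigD1 j) //= eqxx mulr1 big1 ?addr0// => k /negPf ->.
    by rewrite mulr0.
  case: ifP => _ /=; last by rewrite big1 // => k _; rewrite mulr0.
  rewrite [RHS]big_mkcond; apply: eq_bigr => k _.
  by case: ifP => _; rewrite ?mulr0.
have -> : \det (pad (v |: N) x) = \det (pad (v |: N) x *m T).
  by rewrite det_mulmx detT mulr1.
rewrite (@det_col_single (_ *m T) v) => [|i iv]; last first.
  rewrite AT eqxx mxE !in_setU1 eqxx (negPf iv) /= andbT.
  case: ifPn => iN.
    under eq_bigr => k kN do rewrite mxE !in_setU1 iN kN !orbT /=.
    by rewrite xc// subrr.
  rewrite big1 ?subr0// => k kN.
  rewrite mxE !in_setU1 (negPf iN) (negPf iv) /= -[in RHS](mul0r (c k)).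
  by case: eqP kN iN => [->->|//].
rewrite (@det_col_single (pad N x) v) => [|i iv]; last first.
  by rewrite mxE (negPf vN) andbF (negPf iv).
rewrite [pad N x v v]mxE (negPf vN) eqxx mul1r mulrC; congr (\det _ * _).
  apply/matrixP => i j; rewrite mxE mxE AT !mxE !in_setU1.
  by rewrite ![lift _ _ == v]eq_sym !(negPf (neq_lift v _)) subr0.
rewrite AT eqxx mxE !in_setU1 !eqxx /=; congr (_ - _).
by apply: eq_bigr => j jN; rewrite mxE !in_setU1 eqxx jN orbT.
Qed.

(** Kept at size r to avoid reindexing; the entries away from v are those that matter. *)
Definition schur v x : 'M[R]_r := \matrix_(i, j) (x i j - x i v * x v j / x v v).

Lemma schur_sym v x : x^T = x -> (schur v x)^T = schur v x.
Proof.
move=> xs; have xE i j : x i j = x j i by rewrite -{1}xs mxE.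
by apply/matrixP => i j; rewrite !mxE (xE j i) (xE j v) (xE v i) (mulrC (x v j)).
Qed.

Lemma det_restr_schur N x v : v \notin N -> x v v != 0 ->
  \det (restr x (v |: N)) = x v v * \det (restr (schur v x) N).
Proof.
move=> vN x0; rewrite !det_restr.
pose c j := x v j / x v v.
pose T : 'M[R]_r := \matrix_(i, j)
  ((i == j)%:R - if (i == v) && (j \in N) then c j else 0).
have detT : \det T = 1.
  rewrite (@det_col_single _ v) => [|i iv]; last first.
    by rewrite mxE (negPf vN) andbF subr0 (negPf iv).
  rewrite mxE eqxx (negPf vN) subr0 mul1r.
  rewrite (_ : row' _ _ = 1%:M) ?det1//; apply/matrixP => i j; rewrite !mxE.
  by rewrite (inj_eq lift_inj) [lift _ _ == v]eq_sym (negPf (neq_lift v i)) subr0.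
have AT i j : (pad (v |: N) x *m T) i j = pad (v |: N) x i j -
    if j \in N then pad (v |: N) x i v * c j else 0.
  rewrite mxE; under eq_bigr do rewrite [T _ _]mxE mulrBr; rewrite sumrB;
    congr (_ - _).
    rewrite (bigD1 j) //= eqxx mulr1 big1 ?addr0// => k /negPf ->.
    by rewrite mulr0.
  rewrite (bigD1 v) //= eqxx /= big1 ?addr0 => [|k /negPf -> /=].
    by case: ifP; rewrite ?mulr0.
  by rewrite mulr0.
have -> : \det (pad (v |: N) x) = \det (pad (v |: N) x *m T).
  by rewrite det_mulmx detT mulr1.
rewrite (@det_row_single (_ *m T) v) => [|i iv]; last first.
  rewrite AT !mxE !in_setU1 eqxx (negPf iv) /=; case: ifP => iN; last first.
    by rewrite subr0 eq_sym (negPf iv).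
  by rewrite /c mulrCA divff ?mulr1 ?subrr.
rewrite (@det_col_single (pad N _) v) => [|i iv]; last first.
  by rewrite mxE (negPf vN) andbF (negPf iv).
rewrite [pad N _ v v]mxE (negPf vN) eqxx mul1r.
congr (_ * _); first by rewrite AT (negPf vN) subr0 mxE !in_setU1 eqxx.
congr (\det _).
apply/matrixP => i j; rewrite mxE mxE AT !mxE !in_setU1.
rewrite !eqxx ![lift _ _ == v]eq_sym !(negPf (neq_lift v _)) /=.
case: (boolP (lift v i \in N)) => iN; case: (boolP (lift v j \in N)) => jN /=;
  by rewrite ?mul0r ?subr0 ?mulrA.
Qed.

Definition quad N x (u : 'I_r -> R) := \sum_(i in N) \sum_(j in N) u i * x i j * u j.

(** Vectors are functions on all the vertices, of which only the values on N count; passing to a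
    subset or adding a vertex then needs no reindexing. *)
Definition posdef_on N x := forall u : 'I_r -> R,
  (exists2 i, i \in N & u i != 0) -> 0 < quad N x u.

Lemma posdef_onP N x : x^T = x -> posdefmx (restr x N) <-> posdef_on N x.
Proof.
move=> xs.
have qE (w : 'cV[R]_#|N|) u : (forall k, u (enum_val k) = w k ord0) ->
    (w^T *m restr x N *m w) ord0 ord0 = quad N x u.
  move=> uw; rewrite mxE /quad [RHS]exchange_big [RHS]big_enum_val /=;
    apply: eq_bigr => k _.
  rewrite mxE mulr_suml [RHS]big_enum_val /=; apply: eq_bigr => l _.
  by rewrite !mxE !uw.
split=> [[_ p] u [i iN ui]|p].
  rewrite -(qE (\col_k u (enum_val k))) => [|k]; last by rewrite mxE.
  apply: p; apply/eqP => /matrixP /(_ (enum_rank_in iN i) ord0).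
  by rewrite !mxE enum_rankK_in// => u0; rewrite u0 eqxx in ui.
split; first by apply/matrixP => k l; rewrite !mxE -{1}xs mxE.
move=> w w0.
pose u i := if [pick k : 'I_#|N| | enum_val k == i] is Some k then w k ord0 else 0.
have uw k : u (enum_val k) = w k ord0.
  rewrite /u; case: pickP => [l /eqP /enum_val_inj ->//|/(_ k)].
  by rewrite eqxx.
rewrite (qE _ u uw); apply: p.
have [k wk] : exists k, w k ord0 != 0.
  apply/existsP; move: w0; apply: contraR; rewrite negb_exists => /forallP w0.
  by apply/eqP/matrixP => k l; rewrite ord1 mxE; apply/eqP; rewrite -[_ == _]negbK.
by exists (enum_val k); [exact: enum_valP|rewrite uw].
Qed.

Lemma posdef_onS N M x : N \subset M -> posdef_on M x -> posdef_on N x.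
Proof.
move=> NM p u [i iN ui].
have := p (fun i => if i \in N then u i else 0).
have -> : quad M x (fun i => if i \in N then u i else 0) = quad N x u.
  rewrite /quad big_mkcond [RHS]big_mkcond; apply: eq_bigr => k _.
  case: (boolP (k \in N)) => kN; last first.
    by case: ifP => // _; rewrite big1 // => j _; rewrite !mul0r.
  rewrite (fintype.subsetP NM)// big_mkcond [RHS]big_mkcond; apply: eq_bigr => j _.
  case: (boolP (j \in N)) => jN; last by rewrite mulr0 if_same.
  by rewrite (fintype.subsetP NM).
by apply; exists i; [exact: (fintype.subsetP NM)|rewrite iN].
Qed.

Lemma quad_setU1 N x v u : v \notin N -> quad (v |: N) x u =
  u v * x v v * u v + \sum_(j in N) u v * x v j * u j +
  \sum_(i in N) u i * x i v * u v + quad N x u.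
Proof.
move=> vN; rewrite /quad big_setU1//= big_setU1//=.
rewrite [X in _ + X](_ : _ = \sum_(i in N) u i * x i v * u v + quad N x u) ?addrA//.
by rewrite -big_split; apply: eq_bigr => i _; rewrite big_setU1.
Qed.

Lemma eq_quad N x y u w : (forall i, i \in N -> u i = w i) ->
  (forall i j, i \in N -> j \in N -> x i j = y i j) -> quad N x u = quad N y w.
Proof.
by move=> uw xy; apply: eq_bigr => i iN; apply: eq_bigr => j jN; rewrite !uw ?xy.
Qed.

Lemma quad_schurE N x v u : x^T = x -> x v v != 0 ->
  quad N (schur v x) u = quad N x u - (\sum_(j in N) x v j * u j) ^+ 2 / x v v.
Proof.
move=> xs x0; have xE i j : x i j = x j i by rewrite -{1}xs mxE.
rewrite /quad expr2 mulr_suml mulr_suml -sumrB; apply: eq_bigr => i _.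
rewrite mulr_sumr mulr_suml -sumrB; apply: eq_bigr => j _.
by rewrite mxE (xE i v); field.
Qed.

Lemma quad_setU1_sym N x v u : x^T = x -> v \notin N ->
  quad (v |: N) x u =
  x v v * u v ^+ 2 + 2 * (\sum_(j in N) x v j * u j) * u v + quad N x u.
Proof.
move=> xs vN; have xE i j : x i j = x j i by rewrite -{1}xs mxE.
rewrite quad_setU1//.
set s := \sum_(j in N) x v j * u j.
rewrite [X in _ + X + _ + _](_ : _ = u v * s); last first.
  by rewrite mulr_sumr; apply: eq_bigr => j _; rewrite mulrA.
rewrite [X in _ + _ + X + _](_ : _ = u v * s); last first.
  by rewrite mulr_sumr; apply: eq_bigr => j _; rewrite (xE v j); ring.
ring.
Qed.

Lemma quad_schur N x v u : x^T = x -> v \notin N -> x v v != 0 ->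
  quad (v |: N) x u =
  x v v * (u v + (\sum_(j in N) x v j * u j) / x v v) ^+ 2 + quad N (schur v x) u.
Proof.
by move=> xs vN x0; rewrite quad_setU1_sym// quad_schurE//; field.
Qed.

Lemma posdef_on_diag N x v : v \in N -> posdef_on N x -> 0 < x v v.
Proof.
move=> vN /(posdef_onS (N := [set v])) p.
have := p _ (fun => 1); rewrite /quad !big_set1 mul1r mulr1; apply.
  by rewrite finset.sub1set.
by exists v; rewrite ?inE// oner_neq0.
Qed.

Lemma posdef_on_schur N x v : x^T = x -> v \notin N ->
  posdef_on (v |: N) x -> posdef_on N (schur v x).
Proof.
move=> xs vN p u [i iN ui].
have xv : x v v != 0 by rewrite gt_eqF// (posdef_on_diag _ p)// setU11.
(* The value at v is the one that makes the completed square vanish. *)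
pose w j := if j == v then - (\sum_(j in N) x v j * u j) / x v v else u j.
have wu j : j \in N -> w j = u j by rewrite /w; case: eqP => // ->;
  rewrite (negPf vN).
have wv : w v = - (\sum_(j in N) x v j * u j) / x v v by rewrite /w eqxx.
have ws : \sum_(j in N) x v j * w j = \sum_(j in N) x v j * u j.
  by apply: eq_bigr => j jN; rewrite wu.
have := p w; rewrite quad_schur// wv ws.
rewrite mulNr addNr expr0n mulr0 add0r (eq_quad (w := u) (y := schur v x))//; apply.
by exists i; rewrite ?wu// in_setU1 iN orbT.
Qed.

Lemma det_restr0 x : \det (restr x finset.set0) = 1.
Proof.
rewrite det_restr -(det1 R r); congr (\det _).
by apply/matrixP => i j; rewrite !mxE !inE.
Qed.

Lemma posdef_on_det N x : x^T = x -> posdef_on N x -> 0 < \det (restr x N).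
Proof.
have [n Nn] : exists n, #|N| = n by exists #|N|.
elim: n N x Nn => [|n IH] N x Nn xs p.
  by rewrite (cards0_eq Nn) det_restr0.
have [v vN] : exists v, v \in N by apply/set0Pn; rewrite -card_gt0 Nn.
have xv := posdef_on_diag vN p.
have vN' : v \notin N :\ v by rewrite !inE eqxx.
have {}Nn : #|N :\ v| = n by move: Nn; rewrite (cardsD1 v) vN => -[].
move: p; rewrite -(finset.setD1K vN) => p.
rewrite det_restr_schur//; last by rewrite gt_eqF.
rewrite mulr_gt0// IH//; first exact: schur_sym.
exact: posdef_on_schur.
Qed.

Lemma eq_restr N x y : (forall i j, i \in N -> j \in N -> x i j = y i j) ->
  restr x N = restr y N.
Proof. by move=> xy; apply/matrixP => i j; rewrite !mxE xy ?enum_valP. Qed.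

Lemma posdef_on_inv N x : x^T = x -> posdef_on N x ->
  exists B : 'M[R]_r, [/\ B^T = B, posdef_on N B,
    (forall i j, i \in N -> j \in N -> \sum_(k in N) x i k * B k j = (i == j)%:R) &
    \det (restr B N) = (\det (restr x N))^-1].
Proof.
move=> xs p; have d0 := posdef_on_det xs p.
(* [pad N x] is block diagonal up to a permutation, so the N block of its inverse is the inverse of
   x_N. *)
pose X := pad N x; pose B := invmx X.
have Xu : X \in unitmx by rewrite unitmxE unitfE -det_restr gt_eqF.
have XS : X^T = X.
  apply/matrixP => i j; rewrite !mxE andbC [j == i]eq_sym.
  by case: ifP => // _; rewrite -{1}xs mxE.
have BS : B^T = B by rewrite /B trmx_inv XS.
have xB i j : i \in N -> j \in N -> \sum_(k in N) x i k * B k j = (i == j)%:R.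
  move=> iN jN; have /matrixP/(_ i j) := mulmxV Xu; rewrite !mxE => <-.
  rewrite [LHS]big_mkcond; apply: eq_bigr => k _; rewrite mxE iN /=.
  by case: ifPn => // kN; case: eqP kN => [<-|]; rewrite ?iN ?mul0r.
exists B; split=> //; last first.
  apply: (mulfI (lt0r_neq0 d0)); rewrite divff ?gt_eqF// -det_mulmx.
  rewrite -(det1 R #|N|); congr (\det _); apply/matrixP => i j; rewrite !mxE.
  transitivity (\sum_(k < #|N|) x (enum_val i) (enum_val k) * B (enum_val k) (enum_val j)).
    by apply: eq_bigr => k _; rewrite !mxE.
  rewrite -(big_enum_val (A := mem N) (fun k =>
    x (enum_val i) k * B k (enum_val j))).
  by rewrite xB ?enum_valP// (inj_eq enum_val_inj).
move=> u [i iN ui].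
(* Substituting s = x_N^-1 u turns the quadratic form of the inverse into that of x. *)
pose s k := \sum_(j in N) B k j * u j.
have xsu k : k \in N -> \sum_(j in N) x k j * s j = u k.
  move=> kN; under eq_bigr do rewrite mulr_sumr; rewrite exchange_big /=.
  transitivity (\sum_(j in N) (k == j)%:R * u j).
    apply: eq_bigr => j jN; rewrite -(xB k j)// mulr_suml.
    by apply: eq_bigr => l _; rewrite mulrA.
  rewrite (bigD1 k)//= eqxx mul1r big1 ?addr0// => j /andP[_].
  by rewrite eq_sym => /negPf ->; rewrite mul0r.
have -> : quad N B u = quad N x s.
  transitivity (\sum_(k in N) u k * s k).
    apply: eq_bigr => k _; rewrite mulr_sumr.
    by apply: eq_bigr => j _; rewrite mulrA.
  apply: eq_bigr => k kN; rewrite -xsu// mulr_suml.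
  apply: eq_bigr => j jN; ring.
apply: p.
have [/existsP[k /andP[kN sk]]|/existsPn s0] :=
  boolP [exists k, (k \in N) && (s k != 0)].
  by exists k.
case/eqP: ui; rewrite -xsu// big1// => j jN.
by have := s0 j; rewrite jN /= negbK => /eqP ->; rewrite mulr0.
Qed.

Lemma posdef_on_solve N x (b : 'I_r -> R) : x^T = x -> posdef_on N x ->
  exists c : 'I_r -> R, forall i, i \in N -> \sum_(j in N) x i j * c j = b i.
Proof.
move=> xs /(posdef_on_inv xs)[B [_ _ xB _]].
exists (fun j => \sum_(k in N) B j k * b k) => i iN.
under eq_bigr do rewrite mulr_sumr; rewrite exchange_big /=.
transitivity (\sum_(j in N) (i == j)%:R * b j).
  apply: eq_bigr => j jN; rewrite -xB// mulr_suml.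
  by apply: eq_bigr => l _; rewrite mulrA.
rewrite (bigD1 i)//= eqxx mul1r big1 ?addr0// => j /andP[_].
by rewrite eq_sym => /negPf ->; rewrite mul0r.
Qed.

(** One step of Sylvester's criterion: the quotient of the two minors is the Schur complement of
    x_N. *)
Lemma posdef_on_setU1 N x v : x^T = x -> v \notin N ->
  posdef_on (v |: N) x <->
  posdef_on N x /\ 0 < \det (restr x (v |: N)) / \det (restr x N).
Proof.
move=> xs vN; split=> [p|[p w0]].
  have pN : posdef_on N x by apply: posdef_onS p; exact: finset.subsetUr.
  by split=> //; rewrite divr_gt0// posdef_on_det.
have xE i j : x i j = x j i by rewrite -{1}xs mxE.
have d0 := posdef_on_det xs p.
have [c xc] := posdef_on_solve (fun i => x i v) xs p.
move: w0; rewrite (det_restr_setU1 vN xc) mulrC mulKf ?gt_eqF//.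
set w := (X in 0 < X) => w0 u [i iN ui].
(* Here N is eliminated rather than v: with c = x_N^-1 x_Nv, shifting u by [u v * c] absorbs the
   cross terms. *)
have -> : quad (v |: N) x u = w * u v ^+ 2 + quad N x (fun i => u i + u v * c i).
  have xcs : \sum_(k in N) u k * x k v = \sum_(k in N) \sum_(j in N) u k * x k j * c j.
    apply: eq_bigr => k kN; rewrite -xc// mulr_sumr; apply: eq_bigr => j _.
    by rewrite mulrA.
  rewrite quad_setU1// /w.
  have -> : quad N x (fun i => u i + u v * c i) = quad N x u +
      (\sum_(k in N) \sum_(j in N) u k * x k j * c j) * u v +
      u v * (\sum_(k in N) \sum_(j in N) c k * x k j * u j) +
      u v ^+ 2 * (\sum_(k in N) c k * x v k).
    rewrite (_ : \sum_(k in N) c k * x v k =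
        \sum_(k in N) \sum_(j in N) c k * x k j * c j); last first.
      apply: eq_bigr => k kN; rewrite (xE v k) -(xc k)// mulr_sumr.
      by apply: eq_bigr => j _; rewrite mulrA.
    rewrite /quad mulr_suml !mulr_sumr -!big_split /=; apply: eq_bigr => k _.
    rewrite mulr_suml !mulr_sumr -!big_split /=; apply: eq_bigr => j _; ring.
  rewrite -xcs.
  rewrite (_ : \sum_(k in N) \sum_(j in N) c k * x k j * u j =
               \sum_(k in N) u k * x k v); last first.
    rewrite xcs exchange_big /=; apply: eq_bigr => k _; apply: eq_bigr => j _.
    by rewrite (xE j k); ring.
  rewrite (_ : \sum_(k in N) c k * x v k = \sum_(j in N) x v j * c j); last first.
    by apply: eq_bigr => k _; rewrite mulrC.
  rewrite (_ : \sum_(j in N) u v * x v j * u j =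
    u v * \sum_(k in N) u k * x k v); last first.
    by rewrite mulr_sumr; apply: eq_bigr => k _; rewrite (xE k v); ring.
  by rewrite -mulr_suml; ring.
have [uv0|uv0] := eqVneq (u v) 0.
  rewrite uv0 expr0n mulr0 add0r; apply: p; exists i.
    by move: iN; rewrite in_setU1 => /orP[/eqP iv|//]; rewrite iv uv0 eqxx in ui.
  by rewrite mul0r addr0.
have u2 : 0 < w * u v ^+ 2 by rewrite pmulr_rgt0// exprn_even_gt0.
rewrite ltr_wpDr//.
have [/existsP[k /andP[kN sk]]|/existsPn s0] :=
  boolP [exists k, (k \in N) && (u k + u v * c k != 0)].
  by rewrite ltW// p//; exists k.
rewrite /quad big1// => k kN; rewrite big1// => j _.
by have := s0 k; rewrite kN /= negbK => /eqP ->; rewrite !mul0r.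
Qed.

End minors.

(** * Gamma and Gaussian integrals *)

Section one_dimensional_integrals.
Variable R : realType.
Notation mu := (@lebesgue_measure R).

(** The pushforward of Lebesgue measure by the affine map, scaled by a, has the right values on
    half-open intervals, so uniqueness identifies it with Lebesgue measure. *)
Lemma ge0_integral_affine (a b : R) (f : R -> \bar R) : 0 < a ->
  measurable_fun [set: R] f -> (forall t, 0 <= f t)%E ->
  (\int[mu]_t f (a * t + b)%R = (a^-1)%:E * \int[mu]_t f t)%E.
Proof.
move=> a0 mf f0.
pose h : measurableTypeR R -> measurableTypeR R := fun t => a * t + b.
have mh : measurable_fun setT h.
  by apply: measurable_funD => //; apply: measurable_funM.
pose hM : {mfun measurableTypeR R >-> measurableTypeR R} :=
  HB.pack h (isMeasurableFun.Build _ _ _ _ h mh).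
have ia0 : 0 <= a^-1 by rewrite invr_ge0 ltW.
have la0 : 0 <= a by rewrite ltW.
have muE A : measurable A -> pushforward mu hM A = mscale (NngNum ia0) mu A.
  move=> mA; rewrite /mscale /=.
  rewrite (@lebesgue_measure_unique R (mscale (NngNum la0) (pushforward mu hM)) _ A mA).
    by rewrite /mscale /= muleA -EFinM mulVf ?gt_eqF// mul1e.
  move=> _ [[x y] _ <-].
  change (mu `]x, y] = a%:E * mu (h @^-1` `]x, y]))%E.
  rewrite (_ : h @^-1` _ = `](x - b) / a, (y - b) / a]%classic).
    rewrite !lebesgue_measure_itv /= !lte_fin ltr_pM2r ?invr_gt0// ltrD2r.
    case: ifP => _; last by rewrite mule0.
    rewrite -!EFinB -EFinM; congr EFin; field.
    by rewrite gt_eqF.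
  apply/seteqP; split=> t /=; rewrite !in_itv /= /h => /andP[xt ty]; apply/andP.
    by rewrite ltr_pdivrMr// ler_pdivlMr// !(mulrC t) ltrBlDr lerBrDr.
  by move: xt ty; rewrite ltr_pdivrMr// ler_pdivlMr// !(mulrC t) ltrBlDr lerBrDr.
rewrite -(@ge0_integral_mscale _ _ _ mu _ measurableT (NngNum ia0))//.
have := @ge0_integral_pushforward _ _ _ _ R h mh mu setT f measurableT mf
  (fun y _ => f0 y).
rewrite preimage_setT => <-.
by apply: eq_measure_integral => A mA _; exact: muE.
Qed.

Lemma integral_gauss (c b : R) : 0 < c ->
  (\int[mu]_t (expR (- (c * t ^+ 2 + 2 * b * t)))%:E =
   ((pi / c) `^ (1 / 2) * expR (b ^+ 2 / c))%:E)%E.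
Proof.
move=> c0.
(* Standard deviation of the normal density proportional to the integrand; its mean is - b / c. *)
pose s : R := Num.sqrt (1 / (2 * c)).
have s2 : s ^+ 2 = 1 / (2 * c) by rewrite sqr_sqrtr// divr_ge0// mulr_ge0// ltW.
have s0 : s != 0.
  by rewrite gt_eqF// sqrtr_gt0 divr_gt0// mulr_gt0.
have E t : expR (- (c * t ^+ 2 + 2 * b * t)) =
    ((pi / c) `^ (1 / 2) * expR (b ^+ 2 / c)) * normal_pdf (- (b / c)) s t.
  rewrite normal_pdfE// /normal_peak /normal_fun s2.
  have -> : 1 / (2 * c) * pi *+ 2 = pi / c by rewrite -mulr_natr; field;
    rewrite gt_eqF.
  rewrite div1r powR12_sqrt ?divr_ge0 ?pi_ge0 ?ltW//.
  have : Num.sqrt (pi / c) != 0 by rewrite gt_eqF// sqrtr_gt0 divr_gt0// pi_gt0.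
  set q := Num.sqrt _ => q0.
  rewrite [RHS](_ : _ = expR (b ^+ 2 / c) * expR (- (t - - (b / c)) ^+ 2 / (1 / (2 * c) *+ 2))).
    rewrite -expRD; congr expR; rewrite -mulr_natr; field.
    by rewrite gt_eqF.
  by field.
under eq_integral do rewrite E EFinM.
rewrite ge0_integralZl//; last 3 first.
- by apply/measurable_EFinP; exact: measurable_normal_pdf.
- by move=> t _; rewrite lee_fin normal_pdf_ge0.
- by rewrite lee_fin mulr_ge0// ?powR_ge0 ?expR_ge0.
by rewrite integral_normal_pdf// mule1.
Qed.

Lemma powR_integral01 (p : R) : 0 < p ->
  (\int[mu]_(t in `]0%R, 1%R]) (t `^ (p - 1))%:E <= (p^-1)%:E)%E.
Proof.
move=> p0.
(* The left ends 1 / (n + 2) stay strictly between 0 and 1, so the fundamental theorem of calculus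
   applies on each interval to t^p / p; monotone convergence does the rest. *)
pose F (n : nat) : set R := `[n.+2%:R^-1, 1]%classic.
have F0 n : (0 : R) < n.+2%:R^-1 by rewrite invr_gt0 ltr0n.
have FU : `]0%R, 1%R]%classic = \bigcup_n F n.
  apply/seteqP; split=> [t|t [n _]] /=; last first.
    rewrite /F /= !in_itv /= => /andP[nt ->].
    by rewrite (lt_le_trans (F0 n) nt).
  rewrite in_itv /= => /andP[t0 t1].
  exists (Num.bound t^-1) => //; rewrite /F /= in_itv /= t1 andbT.
  rewrite -[leRHS]invrK lef_pV2 ?posrE ?invr_gt0// ?ltr0n//.
  have ti0 : 0 <= t^-1 by rewrite invr_ge0 ltW.
  apply: (le_trans (ltW (archi_boundP ti0))); rewrite ler_nat.
  by rewrite -addn2 leq_addr.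
have mf (A : set R) : measurable_fun A (fun t => (t `^ (p - 1))%:E).
  apply: (@measurable_funS _ _ _ _ [set: R]) => //.
  by apply/measurable_EFinP; exact: measurable_powR.
rewrite FU.
apply: (cvge_to_le (a := \oo) (f := fun n =>
  \int[mu]_(t in F n) (t `^ (p - 1))%:E)%E).
  apply: ge0_nondecreasing_set_cvg_integral => //.
  - apply/nondecreasing_seqP => n; rewrite subsetEset /F => t /=.
    rewrite !in_itv /= => /andP[nt ->]; rewrite andbT (le_trans _ nt)//.
    by rewrite lef_pV2 ?posrE ?ltr0n// ler_nat.
  - by move=> n; exact: measurable_itv.
  - by move=> n; exact: mf.
  - by move=> n t _; rewrite lee_fin powR_ge0.
exists 0%N => // n _ /=.
have dF (t : R) : 0 < t -> is_derive t 1 (fun t : R =>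
  p^-1 * t `^ p) (t `^ (p - 1)).
  move=> t0.
  apply: (is_derive_eq (is_deriveZ p^-1 (is_derive1_powR p t0))).
  by rewrite /GRing.scale /= mulrA mulVf ?mul1r// gt_eqF.
have cF (t : R) : 0 < t -> {for t, continuous (fun t : R => p^-1 * t `^ p)}.
  move=> t0; apply: differentiable_continuous; apply/derivable1_diffP.
  exact: (@ex_derive _ _ _ _ _ _ _ (dF _ t0)).
rewrite (@continuous_FTC2 _ _ (fun t => p^-1 * t `^ p)).
- rewrite powR1 mulr1 -EFinB lee_fin gerBl mulr_ge0 ?powR_ge0// invr_ge0.
  exact: ltW.
- by rewrite invf_lt1 ?ltr0n// ltr1n.
- apply: derivable_within_continuous => t; rewrite in_itv /= => /andP[nt _].
  by apply: derivable_powR; rewrite in_itv /= andbT (lt_le_trans (F0 n)).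
- split.
  + move=> t; rewrite in_itv /= => /andP[nt _].
    apply: (@ex_derive _ _ _ _ _ _ _ (dF _ _)).
    by rewrite (lt_trans (F0 n)).
  + by apply: cvg_at_right_filter; exact: cF.
  + by apply: cvg_at_left_filter; exact: cF.
- move=> t; rewrite in_itv /= => /andP[nt _].
  have t0 : 0 < t by rewrite (lt_trans (F0 n)).
  by rewrite derive1E; exact: (@derive_val _ _ _ _ _ _ _ (dF _ t0)).
Qed.

Let gamma_fun (p t : R) : R := t `^ (p - 1) * expR (- t).

Let measurable_gamma_fun p (A : set R) :
  measurable_fun A (fun t => (gamma_fun p t)%:E).
Proof.
apply: (@measurable_funS _ _ _ _ [set: R]) => //.
apply/measurable_EFinP; apply: measurable_funM; first exact: measurable_powR.
by apply: measurableT_comp => //; exact: measurableT_comp.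
Qed.

Lemma gamma_integral_lty (p : R) : 0 < p ->
  (\int[mu]_(t in `]0%R, +oo[) (t `^ (p - 1) * expR (- t))%:E < +oo)%E.
Proof.
move=> p0.
rewrite (_ : `]0%R, +oo[%classic = `]0%R, 1%R] `|` `]1%R, +oo[); last first.
  by rewrite -itv_bndbnd_setU// ?bnd_simp.
rewrite ge0_integral_setU//; last 3 first.
- exact: measurable_gamma_fun.
- by move=> t _; rewrite lee_fin mulr_ge0 ?powR_ge0 ?expR_ge0.
- apply/disj_setPS => t [] /=; rewrite !in_itv /= andbT => /andP[_ t1].
  by rewrite ltNge t1.
apply: lte_add_pinfty.
  apply: le_lt_trans (ltry (p^-1)); apply: le_trans (powR_integral01 p0).
  apply: ge0_le_integral => //.
  - by move=> t _; rewrite lee_fin mulr_ge0 ?powR_ge0 ?expR_ge0.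
  - exact: measurable_gamma_fun.
  - apply: (@measurable_funS _ _ _ _ [set: R]) => //.
    by apply/measurable_EFinP; exact: measurable_powR.
  - move=> t /=; rewrite in_itv /= => /andP[t0 _]; rewrite lee_fin.
    by rewrite ler_piMr ?powR_ge0// expR_le1 oppr_le0 ltW.
pose n := Num.bound p.
(* From (t / 2)^(n+1) / (n+1)! <= exp (t / 2) and p - 1 <= n + 1. The leading 2 cancels the rate 1/2
   in the exponential density used as majorant. *)
pose K : R := 2 * (n.+1`!%:R * 2 ^+ n.+1).
have K0 : 0 <= K by rewrite pmulr_rge0// mulr_ge0 ?ler0n ?exprn_ge0.
have h0 : 0 < 1 / 2 :> R by lra.
apply: (@le_lt_trans _ _ (\int[mu]_t (K%:E * (exponential_pdf (1 / 2) t)%:E)%E)%E); last first.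
  rewrite ge0_integralZl//; last 2 first.
  - by apply/measurable_EFinP; exact: measurable_exponential_pdf.
  - by move=> t _; rewrite lee_fin exponential_pdf_ge0// ltW.
  by rewrite integral_exponential_pdf// mule1 ltry.
apply: (@le_trans _ _ (\int[mu]_(t in `]1%R, +oo[)
    (K%:E * (exponential_pdf (1 / 2) t)%:E)%E)%E); last first.
  apply: ge0_subset_integral => //.
    apply: measurable_funeM.
    by apply/measurable_EFinP; exact: measurable_exponential_pdf.
  by move=> t _; rewrite mule_ge0// lee_fin ?exponential_pdf_ge0// ltW.
apply: ge0_le_integral => //.
- by move=> t _; rewrite lee_fin mulr_ge0 ?powR_ge0 ?expR_ge0.
- exact: measurable_gamma_fun.
- apply: (@measurable_funS _ _ _ _ [set: R]) => //; apply: measurable_funeM.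
  by apply/measurable_EFinP; exact: measurable_exponential_pdf.
move=> t /=; rewrite in_itv /= andbT => t1; rewrite -EFinM lee_fin.
have t0 : 0 <= t by rewrite ltW// (lt_trans ltr01).
rewrite exponential_pdfE// /K.
have -> : 2 * (n.+1`!%:R * 2 ^+ n.+1) * (1 / 2 * expR (- (1 / 2) * t)) =
  (n.+1`!%:R * 2 ^+ n.+1 * expR (t / 2)) * expR (- t).
  rewrite -[RHS]mulrA -expRD (_ : t / 2 - t = - (1 / 2) * t); last lra.
  lra.
rewrite ler_wpM2r ?expR_ge0//.
apply: (@le_trans _ _ (t ^+ n.+1)).
  rewrite -powR_mulrn// ler_powR ?(ltW t1)//.
  rewrite lerBlDr (le_trans (ltW (archi_boundP (ltW p0))))//.
  by rewrite -natr1 -addrA lerDl.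
have t20 : 0 <= t / 2 by rewrite divr_ge0.
have := expR_ge1Dxn n t20; rewrite expr_div_n => H.
have : t ^+ n.+1 / 2 ^+ n.+1 / n.+1`!%:R <= expR (t / 2).
  by apply: le_trans H; rewrite lerDr.
rewrite ler_pdivrMr ?ltr0n ?fact_gt0// ler_pdivrMr ?exprn_gt0//.
by move=> /le_trans; apply; rewrite le_eqVlt; apply/orP; left; apply/eqP; ring.
Qed.

Lemma integral_Gamma (p : R) : 0 < p ->
  (\int[mu]_t (if 0 < t then t `^ (p - 1) * expR (- t) else 0)%:E = (Gamma p)%:E)%E.
Proof.
move=> p0; rewrite /Gamma /Rintegral fineK; last first.
  rewrite ge0_fin_numE ?gamma_integral_lty//.
  by apply: integral_ge0 => t _; rewrite lee_fin mulr_ge0 ?powR_ge0 ?expR_ge0.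
rewrite [RHS]integral_mkcond; apply: eq_integral => t _.
by rewrite patchE mem_setE in_itv /= andbT; case: ifP.
Qed.

Lemma Gamma_gt0 (p : R) : 0 < p -> 0 < Gamma p.
Proof.
move=> p0; rewrite -lte_fin -integral_Gamma//.
(* On [1, 2], t^p >= 1 gives t^(p-1) >= 1 / t >= 1 / 2, and exp (-t) >= exp (-2). *)
pose c : R := 2^-1 * expR (- 2).
have c0 : 0 < c by rewrite mulr_gt0 ?expR_gt0.
apply: (@lt_le_trans _ _ (\int[mu]_(t in `[1%R, 2%R]) (cst c%:E t))%E).
  rewrite integral_cst//= lebesgue_measure_itv /= lte_fin ltr1n /= -EFinB -EFinM.
  by rewrite lte_fin mulr_gt0//; lra.
rewrite integral_mkcond; apply: ge0_le_integral => //.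
- move=> t _; rewrite patchE; case: ifP => // _.
  by rewrite lee_fin ltW.
- apply/(measurable_restrictT _ _).1 => //.
- apply/measurable_EFinP; apply: measurable_fun_ifT => //.
    exact: measurable_fun_ltr.
  by apply/measurable_EFinP; exact: (@measurable_gamma_fun p).
move=> t _; rewrite patchE mem_setE in_itv /=; case: ifP => [/andP[t1 t2]|_].
  have t0 : 0 < t by rewrite (lt_le_trans ltr01).
  rewrite t0 lee_fin ler_pM ?expR_ge0 ?invr_ge0//; last by rewrite ler_expR lerN2.
  rewrite -[leRHS](mulKf (lt0r_neq0 t0)) mulr_powRB1 ?(ltW t0)//.
  apply: (@le_trans _ _ t^-1); first by rewrite lef_pV2 ?posrE.
  rewrite ler_pMr ?invr_gt0//.
  by rewrite -(powRr0 t) ler_powR// ltW.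
by case: ifP => // _; rewrite lee_fin mulr_ge0 ?powR_ge0 ?expR_ge0.
Qed.

Lemma integral_Gamma_affine (p c q : R) : 0 < p -> 0 < c ->
  (\int[mu]_t (if q < t then (t - q) `^ (p - 1) * expR (- (c * t)) else 0)%:E =
   (Gamma p * c `^ (- p) * expR (- (c * q)))%:E)%E.
Proof.
move=> p0 c0.
pose k : R := c `^ (- (p - 1)) * expR (- (c * q)).
pose f (s : R) : \bar R :=
  (k%:E * (if 0 < s then s `^ (p - 1) * expR (- s) else 0)%:E)%E.
have mg : measurable_fun [set: R]
    (fun s : R => (if 0 < s then s `^ (p - 1) * expR (- s) else 0)%:E).
  apply/measurable_EFinP; apply: measurable_fun_ifT => //.
    exact: measurable_fun_ltr.
  by apply/measurable_EFinP; exact: (@measurable_gamma_fun p).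
have k0 : 0 <= k by rewrite mulr_ge0 ?powR_ge0 ?expR_ge0.
have g0 (s : R) : (0 <= (if 0 < s then s `^ (p - 1) * expR (- s) else 0)%:E :> \bar R)%E.
  by case: ifP => // _; rewrite lee_fin mulr_ge0 ?powR_ge0 ?expR_ge0.
transitivity (\int[mu]_t f (c * t + - (c * q))%R)%E.
  apply: eq_integral => t _; rewrite /f -mulrBr pmulr_rgt0// subr_gt0.
  case: ifP => [qt|_]; last by rewrite mule0.
  rewrite -EFinM; congr EFin.
  rewrite /k powRM ?subr_ge0 ?(ltW c0) ?(ltW qt)// powRN.
  have -> : expR (- (c * t)) = expR (- (c * q)) * expR (- (c * (t - q))).
    by rewrite -expRD; congr expR; ring.
  by field; rewrite gt_eqF// powR_gt0.
rewrite ge0_integral_affine//; last 2 first.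
- by apply: measurable_funeM.
- by move=> t; rewrite mule_ge0// lee_fin.
rewrite ge0_integralZl// ?lee_fin// integral_Gamma// -!EFinM; congr EFin.
rewrite /k (_ : - p = - 1 + - (p - 1)); last by ring.
rewrite [X in _ = _ * X * _]powRD; last by rewrite (gt_eqF c0) implybT.
by rewrite powR_inv1 ?(ltW c0)//; ring.
Qed.

End one_dimensional_integrals.

(** * Iterated integrals over matrix entries *)

Section iterated_integrals.
Variables (R : realType) (r : nat).
Notation mu := (@lebesgue_measure R).
Implicit Types (p q : 'I_r * 'I_r) (s : seq ('I_r * 'I_r)) (x : 'M[R]_r).

(** Both positions of a symmetric pair are written, so symmetric matrices stay symmetric, and p and
    its transpose are the same coordinate. *)
Definition upd x p (u : R) : 'M[R]_r :=
  \matrix_(i, j) if ((i, j) == p) || ((j, i) == p) then u else x i j.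

(** Measurability of a function of matrices, tested on all measurable families
    of matrices instead of with a sigma-algebra on the matrices. *)
Definition measurable_mxfun d' (U : measurableType d') (f : 'M[R]_r -> U) :=
  forall d (T : measurableType d) (X : T -> 'M[R]_r),
    (forall i j, measurable_fun [set: T] (fun t => X t i j)) ->
    measurable_fun [set: T] (fun t => f (X t)).

Definition pint p (f : 'M[R]_r -> \bar R) x : \bar R :=
  (\int[mu]_u f (upd x p u))%E.

(** The head of the list is the innermost variable. *)
Definition iint s (f : 'M[R]_r -> \bar R) : 'M[R]_r -> \bar R :=
  foldl (fun g p => pint p g) f s.

Lemma measurable_upd d (T : measurableType d) (X : T -> 'M[R]_r) (Y : T -> R) p :
  (forall i j, measurable_fun [set: T] (fun t => X t i j)) ->
  measurable_fun [set: T] Y ->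
  forall i j, measurable_fun [set: T] (fun t => upd (X t) p (Y t) i j).
Proof.
move=> mX mY i j; under eq_fun do rewrite mxE.
by case: (((i, j) == p) || ((j, i) == p)); [exact: mY|exact: mX].
Qed.

Lemma pint_ge0 p (f : 'M[R]_r -> \bar R) :
  (forall x, 0 <= f x)%E -> forall x, (0 <= pint p f x)%E.
Proof. by move=> f0 x; apply: integral_ge0. Qed.

Lemma measurable_pint p (f : 'M[R]_r -> \bar R) :
  (forall x, 0 <= f x)%E -> measurable_mxfun f -> measurable_mxfun (pint p f).
Proof.
move=> f0 mf d T X mX.
pose g (z : T * measurableTypeR R) := f (upd (X z.1) p z.2).
have mg : measurable_fun [set: T * measurableTypeR R] g.
  apply: mf; apply: measurable_upd => [i j|]; last exact: measurable_snd.
  exact: (measurableT_comp (mX i j)).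
exact: (measurable_fun_fubini_tonelli_F (m2 := mu) g mg (fun z => f0 _)).
Qed.

Lemma pintC p q (f : 'M[R]_r -> \bar R) :
  (forall x, 0 <= f x)%E -> measurable_mxfun f ->
  pint p (pint q f) = pint q (pint p f).
Proof.
move=> f0 mf.
(* If p and q are the same entry up to transposition, the two operators coincide; otherwise the
   updates commute and Tonelli's theorem applies. *)
have [pq|pq] := boolP ((p == q) || ((p.2, p.1) == q)).
  suff -> : pint p f = pint q f.
    rewrite /pint; apply/funext => x; apply: eq_integral => u _.
    suff updE : upd x p u = upd x q u by rewrite updE.
    case/orP: pq => [/eqP->//|/eqP<-]; apply/matrixP => i j; rewrite !mxE.
    by case: p => a b /=; rewrite !xpair_eqE orbC andbC [X in _ || X]andbC.
  suff updE : upd^~ p = upd^~ q.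
    by rewrite /pint; apply/funext => x; under eq_integral do rewrite (congr1 (fun h => h x _) updE).
  apply/funext => x; apply/funext => u.
  case/orP: pq => [/eqP->//|/eqP<-]; apply/matrixP => i j; rewrite !mxE.
  by case: p => a b /=; rewrite !xpair_eqE orbC andbC [X in _ || X]andbC.
apply/funext => x; rewrite /pint.
have updC u v : upd (upd x p u) q v = upd (upd x q v) p u.
  apply/matrixP => i j; rewrite !mxE.
  case: ifP => ijq; case: ifP => // ijp; case/negP: pq.
  case/orP: ijq ijp => /eqP <- /orP[] /eqP <- /=; rewrite eqxx ?orbT//.
under eq_integral do under eq_integral do rewrite updC.
pose g (z : measurableTypeR R * measurableTypeR R) := f (upd (upd x q z.2) p z.1).
apply: (fubini_tonelli (m1 := mu) (m2 := mu) g) => [|z]; last exact: f0.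
apply: mf; apply: measurable_upd => [i j|]; last exact: measurable_fst.
by apply: measurable_upd => [k l|]; [exact: measurable_cst|exact: measurable_snd].
Qed.

Lemma iint_cons p s (f : 'M[R]_r -> \bar R) : iint (p :: s) f = iint s (pint p f).
Proof. by []. Qed.

Lemma iint_cat s1 s2 (f : 'M[R]_r -> \bar R) :
  iint (s1 ++ s2) f = iint s2 (iint s1 f).
Proof. exact: foldl_cat. Qed.

Lemma iint_rem p s (f : 'M[R]_r -> \bar R) : p \in s ->
  (forall x, 0 <= f x)%E -> measurable_mxfun f ->
  iint s f = iint (rem p s) (pint p f).
Proof.
elim: s f => [//|q s IH] f; rewrite in_cons => /orP[/eqP <-|ps] f0 mf.
  by rewrite [rem _ _]/= eqxx.
rewrite [rem _ _]/=; case: eqVneq => [->//|_].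
rewrite !iint_cons (IH _ ps (pint_ge0 _ f0) (measurable_pint _ f0 mf)).
by rewrite pintC.
Qed.

Lemma iint_perm s1 s2 (f : 'M[R]_r -> \bar R) : perm_eq s1 s2 ->
  (forall x, 0 <= f x)%E -> measurable_mxfun f -> iint s1 f = iint s2 f.
Proof.
elim: s1 s2 f => [|p s1 IH] s2 f s12 f0 mf.
  by rewrite perm_sym in s12; rewrite (perm_nilP s12).
have ps2 : p \in s2 by rewrite -(perm_mem s12) mem_head.
rewrite (iint_rem ps2)// iint_cons; apply: IH.
- by rewrite -(perm_cons p) (perm_trans s12)// perm_to_rem.
- exact: pint_ge0.
- exact: measurable_pint.
Qed.

Lemma upd_swap x i j u : upd x (i, j) u = upd x (j, i) u.
Proof.
by apply/matrixP => k l; rewrite !mxE !xpair_eqE orbC andbC [X in _ || X]andbC.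
Qed.

Lemma iint_map_swap (c : 'I_r * 'I_r -> bool) s (f : 'M[R]_r -> \bar R) :
  iint [seq if c p then p else (p.2, p.1) | p <- s] f = iint s f.
Proof.
elim: s f => [//|p s IH] f; rewrite map_cons !iint_cons IH; congr (iint s _).
case: ifP => // _; case: p => i j /=.
by apply/funext => x; rewrite /pint; under eq_integral do rewrite upd_swap.
Qed.

Lemma eq_iint s (f g : 'M[R]_r -> \bar R) x :
  (forall z : 'M[R]_r, (forall i j, (i, j) \notin s -> (j, i) \notin s ->
    z i j = x i j) ->
     (x^T = x -> z^T = z) -> f z = g z) ->
  iint s f x = iint s g x.
Proof.
elim: s f g => [|p s IH] f g fg; first by apply: fg.
rewrite !iint_cons; apply: IH => z zx xz; rewrite /pint;
  apply: eq_integral => u _; apply: fg => [i j|xs].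
  rewrite !in_cons !negb_or mxE => /andP[/negPf -> ijs] /andP[/negPf -> jis].
  exact: zx.
apply/matrixP => i j; rewrite !mxE orbC; case: ifP => // _.
by rewrite -[in RHS]xz// mxE.
Qed.

Lemma iintZl s (k : R) (f : 'M[R]_r -> \bar R) : 0 <= k ->
  (forall x, 0 <= f x)%E -> measurable_mxfun f ->
  iint s (fun x => k%:E * f x)%E = (fun x => k%:E * iint s f x)%E.
Proof.
move=> k0; elim: s f => [//|p s IH] f f0 mf.
rewrite !iint_cons -(IH _ (pint_ge0 _ f0) (measurable_pint _ f0 mf)).
congr (iint s _); apply/funext => x; rewrite /pint ge0_integralZl//.
by apply: mf; apply: measurable_upd => //.
Qed.

Fixpoint updseq x s (t : seq R) : 'M[R]_r :=
  match s, t with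
  | p :: s', u :: t' => upd (updseq x s' t') p u
  | _, _ => x
  end.

(** [lebesgue_tuple] is a product built by consing one coordinate, so Tonelli's theorem peels off
    the head of the list as the innermost variable. *)
Lemma iint_lebesgue_tuple s n (f : 'M[R]_r -> \bar R) x : size s = n ->
  (forall x, 0 <= f x)%E -> measurable_mxfun f ->
  iint s f x = (\int[lebesgue_tuple R n]_t f (updseq x s (t : n.-tuple _)))%E.
Proof.
move=> + f0 mf.
have mupd m s' i j :
    measurable_fun [set: m.-tuple (measurableTypeR R)]
     (fun t : m.-tuple (measurableTypeR R) => updseq x s' t i j).
  elim: s' m i j => [|p s' IH] m i j /=; first by apply: measurable_cst.
  case: m => [|m].
    rewrite (_ : (fun _ => _) = cst (x i j)); first exact: measurable_cst.
    by apply/funext => t; rewrite (tuple0 t).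
  rewrite (_ : (fun _ => _) = fun t : m.+1.-tuple (measurableTypeR R) =>
      upd (updseq x s' [tuple of behead t]) p (tnth t ord0) i j); last first.
    by apply/funext => t; case/tupleP: t => u t; rewrite tnth0.
  apply: measurable_upd; last exact: measurable_tnth.
  move=> k l; apply: (measurableT_comp (IH m k l)).
  exact: measurable_behead.
elim: n s f f0 mf => [|n IH] [|p s] f f0 mf // => [_|[sn]].
  by rewrite /= integral_dirac// diracT mul1e.
rewrite iint_cons (IH s (pint p f) (pint_ge0 _ f0) (measurable_pint _ f0 mf))//=.
rewrite ge0_integral_pushforward//; last 2 first.
  exact: measurable_tcons.
  apply: mf => i j; exact: (mupd n.+1 (p :: s)).
rewrite preimage_setT (fubini_tonelli2 (m1 := mu) (m2 := lebesgue_tuple R n))//;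
  last first.
  by move=> z; exact: f0.
apply: (@measurableT_comp _ _ _ _ _ _
  (fun t : n.+1.-tuple (measurableTypeR R) => f (updseq x (p :: s) t))).
  apply: mf => i j; exact: (mupd n.+1 (p :: s)).
exact: measurable_tcons.
Qed.

End iterated_integrals.

(** * Closure properties of measurable functions of matrices *)

Section measurable_mxfuns.
Variables (R : realType) (r : nat).
Implicit Types (f g : 'M[R]_r -> R).

Lemma measurable_mxfunD f g : measurable_mxfun f -> measurable_mxfun g ->
  measurable_mxfun (fun x => f x + g x).
Proof.
by move=> mf mg d T X mX; apply: measurable_funD; [exact: mf|exact: mg].
Qed.

Lemma measurable_mxfunN f : measurable_mxfun f -> measurable_mxfun (fun x => - f x).
Proof. by move=> mf d T X mX; apply: measurableT_comp => //; exact: mf. Qed.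

Lemma measurable_mxfunM f g : measurable_mxfun f -> measurable_mxfun g ->
  measurable_mxfun (fun x => f x * g x).
Proof.
by move=> mf mg d T X mX; apply: measurable_funM; [exact: mf|exact: mg].
Qed.

Lemma measurable_mxfun_comp f (h : R -> R) : measurable_fun [set: R] h ->
  measurable_mxfun f -> measurable_mxfun (fun x => h (f x)).
Proof. by move=> mh mf d T X mX; apply: (measurableT_comp mh); exact: mf. Qed.

Lemma measurable_mxfun_cst (c : R) : measurable_mxfun (fun _ : 'M[R]_r => c).
Proof. by move=> d T X mX; exact: measurable_cst. Qed.

Lemma measurable_mxfun_entry i j : measurable_mxfun (fun x : 'M[R]_r => x i j).
Proof. by move=> d T X mX; exact: mX. Qed.

Lemma measurable_mxfun_sum (I : Type) (s : seq I) (P : pred I) (f : I ->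
  'M[R]_r -> R) :
  (forall i, measurable_mxfun (f i)) ->
  measurable_mxfun (fun x => \sum_(i <- s | P i) f i x).
Proof.
move=> mf d T X mX; under eq_fun do rewrite -big_filter.
by apply: measurable_sum => i; exact: mf.
Qed.

Lemma measurable_mxfun_prod (I : Type) (s : seq I) (P : pred I) (f : I ->
  'M[R]_r -> R) :
  (forall i, measurable_mxfun (f i)) ->
  measurable_mxfun (fun x => \prod_(i <- s | P i) f i x).
Proof.
move=> mf; elim: s => [|i s IH].
  move=> d T X mX; under eq_fun do rewrite big_nil; exact: measurable_cst.
move=> d T X mX; under eq_fun do rewrite big_cons.
case: (P i); last exact: IH.
by apply: measurable_funM; [exact: mf|exact: IH].
Qed.

Lemma measurable_mxfun_det n (A : 'M[R]_r -> 'M[R]_n) :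
  (forall i j, measurable_mxfun (fun x => A x i j)) ->
  measurable_mxfun (fun x => \det (A x)).
Proof.
move=> mA; rewrite /determinant; apply: measurable_mxfun_sum => s.
apply: measurable_mxfunM; first exact: measurable_mxfun_cst.
by apply: measurable_mxfun_prod => i; exact: mA.
Qed.

Lemma measurable_mxfun_det_restr N :
  measurable_mxfun (fun x : 'M[R]_r => \det (restr x N)).
Proof.
apply: measurable_mxfun_det => i j.
by move=> d T X mX; under eq_fun do rewrite mxE; exact: mX.
Qed.

Lemma measurable_mxfun_quad N B v :
  measurable_mxfun (fun x : 'M[R]_r => quad N B (x v)).
Proof.
apply: measurable_mxfun_sum => i; apply: measurable_mxfun_sum => j.
apply: measurable_mxfunM; last exact: measurable_mxfun_entry.
apply: measurable_mxfunM; last exact: measurable_mxfun_cst.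
exact: measurable_mxfun_entry.
Qed.

Lemma measurable_mxfun_lin (P : pred 'I_r) (b : 'I_r -> R) v :
  measurable_mxfun (fun x : 'M[R]_r => \sum_(i | P i) b i * x v i).
Proof.
apply: measurable_mxfun_sum => i.
by apply: measurable_mxfunM; [exact: measurable_mxfun_cst|exact: measurable_mxfun_entry].
Qed.

Lemma measurable_mxfun_EFin f : measurable_mxfun f ->
  measurable_mxfun (fun x => (f x)%:E).
Proof. by move=> mf d T X mX; apply/measurable_EFinP; exact: mf. Qed.

Lemma measurable_mxfun_ifpos f g : measurable_mxfun f -> measurable_mxfun g ->
  measurable_mxfun (fun x => if 0 < f x then g x else 0).
Proof.
move=> mf mg d T X mX; apply: measurable_fun_ifT; last exact: measurable_cst.
  by apply: measurable_fun_ltr; [exact: measurable_cst|exact: mf].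
exact: mg.
Qed.

End measurable_mxfuns.

(** * Gaussian integrals over a row of the matrix *)

Section gaussian.
Variables (R : realType) (r : nat) (v : 'I_r).

Let gauss (N : {set 'I_r}) (B : 'M[R]_r) (b : 'I_r -> R) (x : 'M[R]_r) : R :=
  expR (- (quad N B (x v) + 2 * \sum_(i in N) b i * x v i)).

Let measurable_gauss N B b : measurable_mxfun (fun x => (gauss N B b x)%:E).
Proof.
apply: measurable_mxfun_EFin; apply: measurable_mxfun_comp => //.
apply: measurable_mxfunN; apply: measurable_mxfunD.
  exact: measurable_mxfun_quad.
apply: measurable_mxfunM; first exact: measurable_mxfun_cst.
exact: measurable_mxfun_lin.
Qed.

(** Completing the square in x_vm leaves a Gaussian of the same kind in the other entries, with the
    Schur complement of B as its matrix. *)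
Let pint_gauss (N : {set 'I_r}) (B : 'M[R]_r) (b : 'I_r -> R) m x : B^T = B ->
  m \notin N -> v \notin N -> m != v ->
  0 < B m m ->
  pint (v, m) (fun x => (gauss (m |: N) B b x)%:E) x =
  (((pi / B m m) `^ (1 / 2) * expR (b m ^+ 2 / B m m))%:E *
  (gauss N (schur m B) (fun i => (b i - B m i * b m / B m m)%R) x)%:E)%E.
Proof.
move=> Bs mN vN mv Bm.
pose s := \sum_(j in N) B m j * x v j.
pose k := expR (- (quad N B (x v) + 2 * \sum_(i in N) b i * x v i)).
transitivity (\int[lebesgue_measure]_u
    (k%:E * (expR (- (B m m * u ^+ 2 + 2 * (b m + s) * u)))%:E))%E.
  apply: eq_integral => u _; rewrite -EFinM -expRD; congr (expR _)%:E.
  have wm : upd x (v, m) u v m = u by rewrite mxE eqxx.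
  have wN j : j \in N -> upd x (v, m) u v j = x v j.
    move=> jN; rewrite mxE !xpair_eqE eqxx /=.
    have -> : j == m = false by apply: contraNF mN => /eqP <-.
    by have -> : j == v = false by apply: contraNF vN => /eqP <-.
  rewrite quad_setU1_sym// wm big_setU1//= wm.
  rewrite (eq_quad (w := x v) (y := B))//.
  rewrite (eq_bigr (fun j => B m j * x v j)) => [|j jN]; last by rewrite wN.
  rewrite -/s (eq_bigr (fun j => b j * x v j)) => [|j jN]; last by rewrite wN.
  by ring.
rewrite ge0_integralZl//; last 2 first.
- apply/measurable_EFinP; apply: measurableT_comp => //.
  apply: measurableT_comp => //; apply: measurable_funD.
    by apply: measurable_funM => //; exact: measurable_funX.
  exact: measurable_funM.
- by rewrite lee_fin expR_ge0.
rewrite integral_gauss// -!EFinM; congr EFin.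
rewrite mulrCA -[RHS]mulrA; congr (_ * _); rewrite /k -!expRD; congr expR.
rewrite quad_schurE// ?gt_eqF// -/s.
have -> : \sum_(i in N) (b i - B m i * b m / B m m) * x v i =
    \sum_(i in N) b i * x v i - s * (b m / B m m).
  rewrite /s mulr_suml -sumrB; apply: eq_bigr => i _.
  by field; rewrite gt_eqF.
by field; rewrite gt_eqF.
Qed.

(** The same [c] solves the system at every stage: its restriction to the remaining indices solves
    the reduced system of the Schur complement. Hence b.c splits into b_m^2 / B_mm and the reduced
    exponent, while the determinant splits off B_mm. *)
Lemma iint_gauss (s : seq 'I_r) (B : 'M[R]_r) (b c : 'I_r -> R) x :
  uniq s -> v \notin s -> B^T = B -> posdef_on [set i in s] B ->
  (forall i, i \in s -> \sum_(j in [set i in s]) B i j * c j = b i) ->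
  iint [seq (v, i) | i <- s]
    (fun x => (expR (- (quad [set i in s] B (x v) +
                        2 * \sum_(i in [set i in s]) b i * x v i)))%:E) x =
  (pi `^ ((size s)%:R / 2) * \det (restr B [set i in s]) `^ (- (1 / 2)) *
   expR (\sum_(i in [set i in s]) b i * c i))%:E.
Proof.
rewrite -/(gauss _ _ _).
elim: s B b x => [|m s IH] B b x.
  move=> _ _ _ _ _ /=.
  have -> : [set i in [::]] = finset.set0 :> {set 'I_r} by apply/setP => i;
    rewrite !inE.
  rewrite det_restr0 powR1 mul0r powRr0 !mul1r /quad !big_set0 mulr0 addr0 oppr0.
  by [].
rewrite set_cons; set N := [set i in s].
move=> /= /andP[ms us]; rewrite in_cons negb_or => /andP[vm vs] Bs p Bc.
have mN : m \notin N by rewrite inE.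
have vN : v \notin N by rewrite inE.
have Bm : 0 < B m m by apply: posdef_on_diag p; exact: finset.setU11.
have pN := posdef_on_schur Bs mN p.
pose b' i := b i - B m i * b m / B m m.
rewrite (_ : pint _ _ = fun x =>
   (((pi / B m m) `^ (1 / 2) * expR (b m ^+ 2 / B m m))%:E *
   (gauss N (schur m B) b' x)%:E)%E); last first.
  by apply/funext => z; rewrite pint_gauss// eq_sym.
rewrite iintZl//; last 2 first.
- by rewrite mulr_ge0 ?powR_ge0 ?expR_ge0.
- by move=> z; rewrite lee_fin expR_ge0.
have BE i j : B i j = B j i by rewrite -{1}Bs mxE.
have Bmm : B m m != 0 by rewrite gt_eqF.
have Bcm : \sum_(j in N) B m j * c j = b m - B m m * c m.
  by rewrite -Bc ?mem_head// big_setU1//= addrAC subrr add0r.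
rewrite IH//; last 2 first.
- exact: schur_sym.
- move=> i iN; under eq_bigr do rewrite mxE mulrBl.
  rewrite sumrB.
  have -> : \sum_(j in N) B i j * c j = b i - B i m * c m.
    rewrite -Bc ?in_cons ?iN ?orbT// big_setU1//= addrAC subrr add0r.
    by [].
  have -> : \sum_(j in N) B i m * B m j / B m m * c j =
      B i m / B m m * (b m - B m m * c m).
    rewrite -Bcm mulr_sumr; apply: eq_bigr => j _; field.
    by [].
  by rewrite /b' (BE m i); field.
rewrite -EFinM; congr EFin.
rewrite det_restr_schur// big_setU1//=.
have -> : \sum_(i in N) b' i * c i = \sum_(i in N) b i * c i - b m / B m m * (b m - B m m * c m).
  rewrite -Bcm mulr_sumr -sumrB; apply: eq_bigr => j _; rewrite /b'; field.
  by [].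
have dN := posdef_on_det (schur_sym m Bs) pN.
set e1 := expR (b m ^+ 2 / _); set e2 := expR _; set e3 := expR _.
have -> : e3 = e1 * e2.
  by rewrite /e1 /e2 /e3 -expRD; congr expR; field.
rewrite (@powRM _ (B m m)) ?(ltW Bm) ?(ltW dN)//.
rewrite [size _]/= -(natr1 (size s)) (mulrDl _ _ 2^-1) powRD;
  last by rewrite (gt_eqF (pi_gt0 R)) implybT.
rewrite (@powRM _ pi) ?pi_ge0 ?invr_ge0 ?(ltW Bm)//.
rewrite -[(B m m)^-1]powR_inv1 ?(ltW Bm)// -powRrM.
rewrite (_ : -1 * (1 / 2) = - (1 / 2)); last by ring.
rewrite /N; ring.
Qed.

End gaussian.

(** * Elimination of a vertex *)

Lemma measurable_invr (R : realType) : measurable_fun [set: R] (fun u : R => u^-1).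
Proof.
(* [powR] is measurable and inverts nonnegative reals; squaring removes the sign, and at 0 both
   sides are 0 as the inverse of 0 is 0. *)
rewrite (_ : (fun u => _) = (fun u : R => u * (u ^+ 2) `^ (-1))).
  apply: measurable_funM => //.
  by apply: (measurableT_comp (measurable_powR (-1))); exact: measurable_funX.
apply/funext => u; rewrite powR_inv1 ?sqr_ge0//.
have [->|u0] := eqVneq u 0; first by rewrite mul0r invr0.
by field.
Qed.

Section vertex_elimination.
Variables (R : realType) (r : nat).
Implicit Types (v : 'I_r) (N : {set 'I_r}) (x y z : 'M[R]_r).

Definition ratio v N x := \det (restr x (v |: N)) / \det (restr x N).

(** The factor of the density of [H_G mu_G] carried by a vertex.  The powers are
    arranged so that the product over the vertices of [C \ S] telescopes to
    [|x_C| ^ (a - (|C| + 1) / 2) / |x_S| ^ (a - (|S| + 1) / 2)]. *)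
Definition dens (t : 'I_r * {set 'I_r} * R) x : R :=
  let: (v, N, a) := t in
  if 0 < ratio v N x then
    ratio v N x `^ a * \det (restr x (v |: N)) `^ (- (#|N|%:R + 2) / 2) *
      \det (restr x N) `^ ((#|N|%:R + 1) / 2)
  else 0.

Lemma dens_ge0 t x : 0 <= dens t x.
Proof.
by case: t => -[v N] a /=; case: ifP => // _; rewrite !mulr_ge0 ?powR_ge0.
Qed.

Lemma measurable_dens t : measurable_mxfun (dens t).
Proof.
case: t => -[v N] a.
have mr : measurable_mxfun (ratio v N).
  apply: measurable_mxfunM; first exact: measurable_mxfun_det_restr.
  apply: (measurable_mxfun_comp (h := fun u => u^-1)).
    exact: measurable_invr.
  exact: measurable_mxfun_det_restr.
apply: measurable_mxfun_ifpos => //.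
have mp p f : measurable_mxfun f -> measurable_mxfun (fun x => f x `^ p : R).
  by move=> mf; apply: (measurable_mxfun_comp (h := fun u => u `^ p)).
apply: measurable_mxfunM; last by apply: mp; exact: measurable_mxfun_det_restr.
apply: measurable_mxfunM; first exact: mp.
by apply: mp; exact: measurable_mxfun_det_restr.
Qed.

Let vertex_fun v N a y x : R :=
  expR (- (y v v * x v v + 2 * \sum_(n in N) y v n * x v n)) * dens (v, N, a) x.

(** [B] is the inverse of x_N, and the ratio at v is x_vv - q with q = x_vN x_N^-1 x_Nv. The Gamma
    integral is thus shifted by q, and the shift yields the Gaussian weight exp (- y_vv q) of the
    row. *)
Let pint_vertex v N a y x B z : v \notin N -> #|N|%:R / 2 < a -> 0 < y v v ->
  B^T = B ->
  (forall i j, i \in N -> j \in N -> \sum_(k in N) x i k * B k j = (i == j)%:R) ->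
  0 < \det (restr x N) -> z^T = z ->
  (forall i j, i \in N -> j \in N -> z i j = x i j) ->
  pint (v, v) (fun x => (vertex_fun v N a y x)%:E) z =
  ((\det (restr x N) `^ (- (1 / 2)) * (Gamma (a - #|N|%:R / 2) *
    y v v `^ (- (a - #|N|%:R / 2))))%:E *
   (expR (- (quad N (y v v *: B) (z v) + 2 * \sum_(n in N) y v n * z v n)))%:E)%E.
Proof.
move=> vN aN yv Bs xB; set D := \det (restr x N) => D0 zs zx.
set n : R := #|N|%:R; set p := a - n / 2.
have zE i j : z i j = z j i by rewrite -{1}zs mxE.
pose q := quad N B (z v).
pose S := \sum_(i in N) y v i * z v i.
have p0 : 0 < p by rewrite subr_gt0.
have vfE (u : R) : vertex_fun v N a y (upd z (v, v) u) =
  expR (- (2 * S)) * D `^ (- (1 / 2)) *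
    (if q < u then (u - q) `^ (p - 1) * expR (- (y v v * u)) else 0).
  set w := upd z (v, v) u.
  have wvv : w v v = u by rewrite mxE eqxx.
  have wE i j : i \in N -> w i j = z i j /\ w j i = z j i.
    move=> iN; rewrite !mxE !xpair_eqE.
    have -> : i == v = false by apply: contraNF vN => /eqP <-.
    by rewrite andbF.
  have wN : \det (restr w N) = D.
    rewrite (@eq_restr _ _ N w x)// => i j iN jN.
    by rewrite (wE _ _ iN).1 zx.
  have wvN : \det (restr w (v |: N)) = D * (u - q).
    pose c j := \sum_(k in N) B j k * z k v.
    rewrite (@det_restr_setU1 _ _ N w v c)// => [|i iN]; last first.
      rewrite (wE _ _ iN).1.
      transitivity (\sum_(j in N) (i == j)%:R * z j v).
        transitivity (\sum_(j in N) \sum_(k in N) x i j * (B j k * z k v)).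
          apply: eq_bigr => j jN; rewrite (wE _ _ iN).1 zx// mulr_sumr.
          by [].
        rewrite exchange_big; apply: eq_bigr => k kN.
        by rewrite -xB// mulr_suml; apply: eq_bigr => j _; rewrite mulrA.
      rewrite (bigD1 i)//= eqxx mul1r big1 ?addr0// => j /andP[_].
      by rewrite eq_sym => /negPf ->; rewrite mul0r.
    rewrite wN wvv; congr (_ * (_ - _)).
    apply: eq_bigr => j jN; rewrite (wE _ _ jN).2 mulr_sumr.
    by apply: eq_bigr => k kN; rewrite mulrA (zE k v).
  rewrite /vertex_fun /dens /ratio wN wvN mulrC (mulrC D) mulfK ?gt_eqF//.
  rewrite wvv (eq_bigr (fun i => y v i * z v i)) => [|i iN]; last first.
    by rewrite (wE _ _ iN).2.
  rewrite -/S -/n subr_gt0; case: ifPn => [qu|_]; last by rewrite mul0r mulr0.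
  have uq : 0 < u - q by rewrite subr_gt0.
  rewrite powRM ?ltW// [- (y v v * u + _)]opprD expRD.
  have -> : (u - q) `^ (p - 1) = (u - q) `^ a * (u - q) `^ (- (n + 2) / 2).
    rewrite -powRD; last by rewrite (gt_eqF uq) implybT.
    by congr (_ `^ _); rewrite /p; field.
  have -> : D `^ (- (1 / 2)) = D `^ (- (n + 2) / 2) * D `^ ((n + 1) / 2).
    rewrite -powRD; last by rewrite (gt_eqF D0) implybT.
    by congr (_ `^ _); field.
  by ring.
rewrite /pint; under eq_integral do rewrite vfE EFinM.
have c0 : 0 <= expR (- (2 * S)) * D `^ (- (1 / 2)).
  by rewrite mulr_ge0 ?expR_ge0 ?powR_ge0.
rewrite ge0_integralZl//; last 2 first.
- apply/measurable_EFinP; apply: measurable_fun_ifT => //.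
    by apply: measurable_fun_ltr.
  apply: measurable_funM.
    by apply: (measurableT_comp (measurable_powR (p - 1))); exact: measurable_funB.
  by apply: measurableT_comp => //; apply: measurableT_comp => //;
    exact: measurable_funM.
- by move=> u _; case: ifP => // _; rewrite lee_fin mulr_ge0 ?powR_ge0 ?expR_ge0.
rewrite integral_Gamma_affine// -!EFinM; congr EFin.
rewrite [- (quad _ _ _ + _)]opprD expRD -/S.
have -> : quad N (y v v *: B) (z v) = y v v * q.
  rewrite /q /quad mulr_sumr; apply: eq_bigr => i _; rewrite mulr_sumr.
  by apply: eq_bigr => j _; rewrite mxE; ring.
ring.
Qed.

(** The factor |x_N|^(-1/2) left by the integral over x_vv cancels against the Gaussian determinant
    |y_vv x_N^-1|^(-1/2) = y_vv^(-|N|/2) |x_N|^(1/2). Hence x_N survives only in the exponential. *)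
Lemma iint_vertex v N a y x : v \notin N -> #|N|%:R / 2 < a -> 0 < y v v ->
  x^T = x -> posdef_on N x ->
  iint ((v, v) :: [seq (v, n) | n <- enum N])
    (fun z => (expR (- (y v v * z v v + 2 * \sum_(n in N) y v n * z v n)) *
               dens (v, N, a) z)%:E) x =
  (pi `^ (#|N|%:R / 2) * Gamma (a - #|N|%:R / 2) * y v v `^ (- a) *
   expR (\sum_(i in N) \sum_(j in N) y v i * x i j * y v j / y v v))%:E.
Proof.
move=> vN aN yv xs px.
have D0 := posdef_on_det xs px.
have [B [Bs pB xB dB]] := posdef_on_inv xs px.
set D := \det (restr x N) in D0 dB.
set n : R := #|N|%:R; set p := a - n / 2.
pose k := D `^ (- (1 / 2)) * (Gamma p * y v v `^ (- p)).
have p0 : 0 < p by rewrite subr_gt0.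
have k0 : 0 <= k.
  by rewrite !mulr_ge0 ?powR_ge0// ltW// Gamma_gt0.
pose Y := y v v *: B.
rewrite iint_cons (eq_iint (g := fun z => (k%:E *
    (expR (- (quad [set i in enum N] Y (z v) +
              2 * \sum_(n in [set i in enum N]) y v n * z v n)))%:E)%E));
                last first.
  move=> z zx zs; rewrite (pint_vertex (x := x) (B := B))//.
  - by rewrite set_enum.
  - exact: zs.
  - have nN i j : i \in N -> (i, j) \notin [seq (v, n) | n <- enum N].
      move=> iN; apply/negP => /mapP[k' _ [iv _]].
      by rewrite -iv iN in vN.
    by move=> i j iN jN; apply: zx; exact: nN.
rewrite iintZl//; last first.
  apply: measurable_mxfun_EFin; apply: measurable_mxfun_comp => //.
  apply: measurable_mxfunN; apply: measurable_mxfunD.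
    exact: measurable_mxfun_quad.
  apply: measurable_mxfunM; first exact: measurable_mxfun_cst.
  exact: measurable_mxfun_lin.
have Ys : Y^T = Y by rewrite /Y linearZ /= Bs.
pose c j := \sum_(l in N) x j l * y v l / y v v.
rewrite (@iint_gauss _ _ v (enum N) Y (y v) c x) ?enum_uniq ?mem_enum//;
  last 2 first.
- rewrite set_enum => u [i iN ui].
  have -> : quad N Y u = y v v * quad N B u.
    rewrite /quad mulr_sumr; apply: eq_bigr => l _; rewrite mulr_sumr.
    by apply: eq_bigr => j _; rewrite mxE; ring.
  by rewrite mulr_gt0//; apply: pB; exists i.
- move=> i; rewrite mem_enum => iN; rewrite set_enum.
  have BE l j : B l j = B j l by rewrite -{1}Bs mxE.
  have xE l j : x l j = x j l by rewrite -{1}xs mxE.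
  transitivity (\sum_(j in N) (j == i)%:R * y v j).
    transitivity (\sum_(j in N) \sum_(l in N) x l j * B j i * y v l).
      apply: eq_bigr => j jN; rewrite mulr_sumr; apply: eq_bigr => l lN.
      by rewrite mxE (BE i j) (xE j l); field; rewrite gt_eqF.
    rewrite exchange_big; apply: eq_bigr => l lN.
    by rewrite -xB// mulr_suml.
  rewrite (bigD1 i)//= eqxx mul1r big1 ?addr0// => j /andP[_].
  by move=> /negPf ->; rewrite mul0r.
rewrite -EFinM; congr EFin; rewrite set_enum -cardE -/n.
have -> : \sum_(i in N) y v i * c i =
    \sum_(i in N) \sum_(j in N) y v i * x i j * y v j / y v v.
  apply: eq_bigr => i _; rewrite mulr_sumr; apply: eq_bigr => j _.
  by rewrite !mulrA.
have -> : \det (restr Y N) = y v v `^ n / D.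
  rewrite (_ : restr Y N = y v v *: restr B N); last first.
    by apply/matrixP => i j; rewrite !mxE.
  by rewrite detZ dB powR_mulrn// ltW.
set E := expR _.
rewrite powRM ?powR_ge0 ?invr_ge0 ?(ltW D0)// -powRrM -[D^-1]powR_inv1 ?(ltW D0)//.
rewrite -powRrM (_ : -1 * - (1 / 2) = 1 / 2); last by ring.
have -> : y v v `^ (- a) = y v v `^ (- p) * y v v `^ (n * - (1 / 2)).
  rewrite -powRD; last by rewrite (gt_eqF yv) implybT.
  by congr (_ `^ _); rewrite /p; field.
rewrite /k powRN.
by field; rewrite gt_eqF// powR_gt0.
Qed.

End vertex_elimination.

(** * Perfect elimination orders *)

Section perfect_elimination.
Variables (R : realType) (r : nat) (e : rel 'I_r).
Hypotheses (e_refl : reflexive e) (e_sym : symmetric e).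
Notation entry := ('I_r * {set 'I_r} * R)%type.
Implicit Types (v : 'I_r) (N M U : {set 'I_r}) (x y z : 'M[R]_r) (t : entry)
  (L : seq entry).

Definition vset L : {set 'I_r} := [set v in [seq t.1.1 | t <- L]].

(** An entry [(v, N, a)] of an elimination list carries a vertex [v], the set [N]
    of its neighbours among the vertices of the tail of the list, and the exponent
    attached to [v]; the head of the list is eliminated first. *)
Fixpoint elimination L : Prop :=
  if L is (v, N, a) :: L' then
    [/\ v \notin vset L', N = [set u in vset L' | e u v], complete e N,
        #|N|%:R / 2 < a & elimination L']
  else True.

(** The diagonal entry precedes the row, because the row becomes Gaussian once x_vv is integrated
    out. *)
Fixpoint elim_coords L : seq ('I_r * 'I_r) :=
  if L is (v, N, _) :: L' then
    ((v, v) :: [seq (v, n) | n <- enum N]) ++ elim_coords L'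
  else [::].

Definition pair_on U x y := \sum_(i in U) \sum_(j in U) x i j * y i j.

(** Product of the pivots of y, each read after the preceding Schur complements and raised to minus
    the exponent of its vertex. *)
Fixpoint elim_pow L y : R :=
  if L is (v, _, a) :: L' then y v v `^ (- a) * elim_pow L' (schur v y) else 1.

Lemma vset_cons v N (a : R) L : vset ((v, N, a) :: L) = v |: vset L.
Proof. by rewrite /vset /= set_cons. Qed.

Lemma completeP M : reflect {in M &, forall i j, e i j} (complete e M).
Proof.
apply: (iffP forall_inP) => [h i j iM jM|h i iM].
  by have /forall_inP := h i iM; apply.
by apply/forall_inP => j jM; exact: h.
Qed.

Lemma elimination_sub L t : elimination L -> t \in L ->
  t.1.1 |: t.1.2 \subset vset L.
Proof.
elim: L => // -[[v N] a] L IH [vL NE _ _ wL]; rewrite in_cons vset_cons.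
case/orP => [/eqP-> /=|tL].
  by apply: finset.setUS; apply/fintype.subsetP => u; rewrite NE inE => /andP[].
by apply: (fintype.subset_trans (IH wL tL)); exact: finset.subsetUr.
Qed.

Lemma elimination_complete L t : elimination L -> t \in L ->
  complete e (t.1.1 |: t.1.2).
Proof.
elim: L => // -[[v N] a] L IH [vL NE cN _ wL]; rewrite in_cons.
case/orP => [/eqP-> /=|tL]; last exact: IH.
apply/completeP => i j; rewrite !in_setU1.
case/orP => [/eqP->|iN]; case/orP => [/eqP->|jN]; first exact: e_refl.
- by move: jN; rewrite NE inE e_sym => /andP[].
- by move: iN; rewrite NE inE => /andP[].
- by move/completeP: cN; apply.
Qed.

(** A complete set containing the head v lies in v |: N, since N holds all the neighbours of v in
    the tail; [posdef_on_setU1] then goes from N to v |: N. So the tests inside [dens] describe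
    [Q_G]. *)
Lemma posdef_on_elimination L z : elimination L -> z^T = z ->
  (forall t, t \in L -> 0 < ratio t.1.1 t.1.2 z) ->
  forall M, complete e M -> M \subset vset L -> posdef_on M z.
Proof.
move=> + zs; elim: L => [|[[v N] a] L IH].
  move=> _ _ M _ /fintype.subsetP ML u [i /ML]; by rewrite inE.
move=> [vL NE cN _ eL] rL M cM; rewrite vset_cons => ML.
have {}IH := IH eL (fun t tL => rL t (mem_behead (s := _ :: _) tL)).
have [vM|vM] := boolP (v \in M); last first.
  apply: IH => //; apply/fintype.subsetP => u uM.
  have := fintype.subsetP ML u uM; rewrite in_setU1 => /orP[/eqP uv|//].
  by rewrite -uv uM in vM.
have NL : N \subset vset L by rewrite NE; apply/fintype.subsetP => u;
  rewrite inE => /andP[].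
have vN : v \notin N by rewrite NE inE (negPf vL).
apply: (@posdef_onS _ _ _ (v |: N)).
  apply/fintype.subsetP => u uM; rewrite in_setU1.
  have := fintype.subsetP ML u uM; rewrite in_setU1 => /orP[->//|uL].
  by rewrite NE inE uL (completeP _ cM) ?orbT.
apply/(posdef_on_setU1 zs vN); split; first exact: IH.
exact: (rL (v, N, a) (mem_head _ _)).
Qed.

Lemma sum_subset (f : 'I_r -> R) N U : N \subset U ->
  (forall i, i \in U -> i \notin N -> f i = 0) ->
  \sum_(i in U) f i = \sum_(i in N) f i.
Proof.
move=> NU f0; rewrite [LHS]big_mkcond [RHS]big_mkcond; apply: eq_bigr => i _.
have [iN|iN] := boolP (i \in N); first by rewrite (fintype.subsetP NU).
by case: ifP => // iU; rewrite f0.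
Qed.

Lemma pair_on_setU1 U N v x y : x^T = x -> y^T = y -> v \notin U ->
  N \subset U -> (forall i, i \in U -> i \notin N -> y v i = 0) ->
  pair_on (v |: U) x y =
  pair_on U x y + (y v v * x v v + 2 * \sum_(n in N) y v n * x v n).
Proof.
move=> xs ys vU NU yN.
have xE i j : x i j = x j i by rewrite -{1}xs mxE.
have yE i j : y i j = y j i by rewrite -{1}ys mxE.
rewrite /pair_on big_setU1//= big_setU1//=.
have -> : \sum_(i in U) \sum_(j in v |: U) x i j * y i j =
    \sum_(i in U) (y v i * x v i + \sum_(j in U) x i j * y i j).
  by apply: eq_bigr => i _; rewrite big_setU1//= (xE i v) (yE i v) (mulrC (x v i)).
rewrite big_split /=.
have -> : \sum_(j in U) x v j * y v j = \sum_(j in U) y v j * x v j.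
  by apply: eq_bigr => j _; rewrite mulrC.
rewrite (sum_subset NU) => [|i iU iN]; last by rewrite yN// mul0r.
by ring.
Qed.

(** The correction is the exponent produced by [iint_vertex], which is why y is replaced by its
    Schur complement. *)
Lemma pair_on_schur U N v x y : y^T = y ->
  N \subset U -> (forall i, i \in U -> i \notin N -> y v i = 0) ->
  pair_on U x (schur v y) =
  pair_on U x y - \sum_(i in N) \sum_(j in N) y v i * x i j * y v j / y v v.
Proof.
move=> ys NU yN; have yE i j : y i j = y j i by rewrite -{1}ys mxE.
rewrite -(sum_subset NU) => [|i iU iN]; last first.
  by rewrite big1// => j _; rewrite yN// !mul0r.
rewrite /pair_on -sumrB; apply: eq_bigr => i iU.
rewrite -(sum_subset NU) => [|j jU jN]; last by rewrite (yN j)// mulr0 mul0r.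
rewrite -sumrB; apply: eq_bigr => j jU; rewrite mxE (yE i v); ring.
Qed.

Lemma eq_dens v N (a : R) x y :
  (forall i j, i \in v |: N -> j \in v |: N -> x i j = y i j) ->
  dens (v, N, a) x = dens (v, N, a) y.
Proof.
move=> xy; rewrite /dens /ratio (@eq_restr _ _ (v |: N) x y)//.
by rewrite (@eq_restr _ _ N x y)// => i j iN jN; rewrite xy// in_setU1 ?iN ?jN orbT.
Qed.

Lemma measurable_prod_dens L : measurable_mxfun (fun x => \prod_(t <- L) dens t x).
Proof. by apply: measurable_mxfun_prod => t; exact: measurable_dens. Qed.

Lemma measurable_pair_on U y : measurable_mxfun (fun x => pair_on U x y).
Proof.
apply: measurable_mxfun_sum => i; apply: measurable_mxfun_sum => j.
by apply: measurable_mxfunM; [exact: measurable_mxfun_entry|exact: measurable_mxfun_cst].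
Qed.

Lemma measurable_elim_integrand U L y :
  measurable_mxfun (fun z => (expR (- pair_on U z y) * \prod_(t <- L) dens t z)%:E).
Proof.
apply: measurable_mxfun_EFin; apply: measurable_mxfunM;
  last exact: measurable_prod_dens.
apply: measurable_mxfun_comp => //; apply: measurable_mxfunN.
exact: measurable_pair_on.
Qed.

Lemma prod_dens_ge0 L x : 0 <= \prod_(t <- L) dens t x.
Proof. by apply: prodr_ge0 => t _; exact: dens_ge0. Qed.

Lemma iint_elimination L y x : elimination L -> y^T = y -> posdef_on (vset L) y ->
  (forall i j, i \in vset L -> j \in vset L -> ~~ e i j -> y i j = 0) -> x^T = x ->
  iint (elim_coords L)
    (fun z => (expR (- pair_on (vset L) z y) * \prod_(t <- L) dens t z)%:E) x =
  ((\prod_(t <- L) (pi `^ (#|t.1.2|%:R / 2) * Gamma (t.2 - #|t.1.2|%:R / 2))) *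
   elim_pow L y)%:E.
Proof.
elim: L y => [|[[v N] a] L IH] y.
  move=> _ _ _ _ _; rewrite /= /pair_on (_ : vset [::] = finset.set0); last first.
    by apply/setP => i; rewrite !inE.
  by rewrite !big_nil big_set0 oppr0 expR0 !mulr1.
move=> /[dup] eL' [vL NE cN aN eL] ys; rewrite vset_cons => py y0 xs.
have yv : 0 < y v v by apply: posdef_on_diag py; exact: finset.setU11.
have NL : N \subset vset L by rewrite NE; apply/fintype.subsetP => u;
  rewrite inE => /andP[].
have vN : v \notin N by rewrite NE inE (negPf vL).
have yN i : i \in vset L -> i \notin N -> y v i = 0.
  move=> iL; rewrite NE inE iL /= e_sym => /y0; apply; first exact: finset.setU11.
  by rewrite in_setU1 iL orbT.
set U := vset L.
set c := pi `^ (#|N|%:R / 2) * Gamma (a - #|N|%:R / 2) * y v v `^ (- a).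
have c0 : 0 <= c by rewrite !mulr_ge0 ?powR_ge0// ltW// Gamma_gt0// subr_gt0.
set s := (v, v) :: [seq (v, n) | n <- enum N].
rewrite (_ : elim_coords _ = s ++ elim_coords L)// iint_cat.
rewrite (eq_iint (g := fun z => (c%:E *
    (expR (- pair_on U z (schur v y)) * \prod_(t <- L) dens t z)%:E)%E));
      last first.
  move=> z _ /(_ xs) zs.
  (* The factors of the tail involve only entries indexed by [vset L], which the integrations at v
     leave untouched, so they come out as a constant. *)
  pose k := expR (- pair_on U z y) * \prod_(t <- L) dens t z.
  rewrite (eq_iint (g := fun w => (k%:E *
     (expR (- (y v v * w v v + 2 * \sum_(n in N) y v n * w v n)) *
               dens (v, N, a) w)%:E)%E)); last first.
    move=> w wz /(_ zs) ws.
    have wzU i j : i \in U -> j \in U -> w i j = z i j.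
      have inU m l : m \in U -> (m, l) \notin s.
        move=> mU; rewrite in_cons negb_or; apply/andP; split.
          by apply: contraNN vL => /eqP[<- _].
        by apply/negP => /mapP[n _ [mv _]]; rewrite -mv mU in vL.
      by move=> iU jU; apply: wz; exact: inU.
    rewrite -EFinM; congr EFin; rewrite big_cons (pair_on_setU1 ws ys vL NL yN).
    rewrite opprD expRD /k.
    have -> : pair_on U w y = pair_on U z y.
      by apply: eq_bigr => i iU; apply: eq_bigr => j jU; rewrite wzU.
    have -> : \prod_(t <- L) dens t w = \prod_(t <- L) dens t z.
      rewrite big_seq [RHS]big_seq; apply: eq_bigr => t tL.
      have /fintype.subsetP tU := elimination_sub eL tL.
      case: t tL tU => -[m M] b tL tU; apply: eq_dens => i j iM jM.
      by apply: wzU; exact: tU.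
    by ring.
  rewrite iintZl; last 3 first.
  - by rewrite mulr_ge0 ?expR_ge0 ?prod_dens_ge0.
  - by move=> w; rewrite lee_fin mulr_ge0 ?expR_ge0 ?dens_ge0.
  - apply: measurable_mxfun_EFin; apply: measurable_mxfunM;
    last exact: measurable_dens.
    apply: measurable_mxfun_comp => //.
    apply: measurable_mxfunN; apply: measurable_mxfunD.
      apply: measurable_mxfunM; first exact: measurable_mxfun_cst.
      exact: measurable_mxfun_entry.
    apply: measurable_mxfunM; first exact: measurable_mxfun_cst.
    exact: measurable_mxfun_lin.
  (* If the tail density vanishes, both sides are 0; otherwise its ratios are all positive, which
     makes z positive definite on N as [iint_vertex] requires. *)
  have [p0|p0] := eqVneq (\prod_(t <- L) dens t z) 0.
    by rewrite /k p0 !mulr0 mul0e mule0.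
  have pN : posdef_on N z.
    apply: (posdef_on_elimination eL zs) => // t tL.
    rewrite ltNge; apply/negP => t0; case/eqP: p0.
    apply/eqP; rewrite prodf_seq_eq0; apply/hasP; exists t => //=.
    by case: t t0 tL => -[m M] b /= t0 _; rewrite ltNge t0.
  rewrite iint_vertex// -!EFinM; congr EFin.
  rewrite /k (pair_on_schur _ ys NL yN) opprB expRD -/c.
  by ring.
rewrite iintZl//; last 2 first.
- by move=> w; rewrite lee_fin mulr_ge0 ?expR_ge0 ?prod_dens_ge0.
- exact: measurable_elim_integrand.
rewrite (IH (schur v y))//; last 3 first.
- exact: schur_sym.
- exact: posdef_on_schur.
(* No fill-in: y_iv y_vj / y_vv can be nonzero only for i and j in N, and N is complete. *)
- move=> i j iL jL ij; rewrite mxE y0// ?in_setU1 ?iL ?jL ?orbT// sub0r.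
  have [iN|iN] := boolP (i \in N); last first.
    have yE k l : y k l = y l k by rewrite -{1}ys mxE.
    by rewrite (yE i v) yN// !mul0r oppr0.
  have [jN|jN] := boolP (j \in N); last by rewrite (yN j)// mulr0 mul0r oppr0.
  by rewrite (completeP _ cN) in ij.
by rewrite -EFinM; congr EFin; rewrite big_cons /c /=; ring.
Qed.

(** [s] is the inverse of y on the vertex set. Away from v it is the inverse of [schur v y], so the
    same [s] serves throughout the induction. *)
Lemma elim_powE L y (s : 'M[R]_r) : elimination L -> y^T = y -> s^T = s ->
  posdef_on (vset L) y -> posdef_on (vset L) s ->
  (forall i j, i \in vset L -> j \in vset L -> ~~ e i j -> y i j = 0) ->
  (forall i j, i \in vset L -> j \in vset L ->
     \sum_(k in vset L) y i k * s k j = (i == j)%:R) ->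
  elim_pow L y = \prod_(t <- L) ratio t.1.1 t.1.2 s `^ t.2.
Proof.
move=> + + ss; elim: L y => [|[[v N] a] L IH] y; first by rewrite big_nil.
move=> [vL NE cN aN eL] ys; rewrite vset_cons => py ps y0 yS.
have yv : 0 < y v v by apply: posdef_on_diag py; exact: finset.setU11.
have NL : N \subset vset L by rewrite NE; apply/fintype.subsetP => u;
  rewrite inE => /andP[].
have vN : v \notin N by rewrite NE inE (negPf vL).
have yN i : i \in vset L -> i \notin N -> y v i = 0.
  move=> iL; rewrite NE inE iL /= e_sym => /y0; apply; first exact: finset.setU11.
  by rewrite in_setU1 iL orbT.
have yE i j : y i j = y j i by rewrite -{1}ys mxE.
have sE i j : s i j = s j i by rewrite -{1}ss mxE.
have vyS j : j \in v |: vset L ->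
    y v v * s v j + \sum_(k in N) y v k * s k j = (v == j)%:R.
  move=> jL; rewrite -(yS v j)// ?finset.setU11// big_setU1//=; congr (_ + _).
  by apply/esym/sum_subset => // i iL iN; rewrite yN// mul0r.
rewrite [elim_pow _ _]/= big_cons /= (IH (schur v y))//; last 5 first.
- exact: schur_sym.
- exact: posdef_on_schur.
- by apply: posdef_onS ps; exact: finset.subsetUr.
- move=> i j iL jL ij; rewrite mxE y0// ?in_setU1 ?iL ?jL ?orbT// sub0r.
  have [iN|iN] := boolP (i \in N); last by rewrite (yE i v) yN// !mul0r oppr0.
  have [jN|jN] := boolP (j \in N); last by rewrite (yN j)// mulr0 mul0r oppr0.
  by rewrite (completeP _ cN) in ij.
- move=> i j iL jL.
  have jvL : j \in v |: vset L by rewrite in_setU1 jL orbT.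
  have ivL : i \in v |: vset L by rewrite in_setU1 iL orbT.
  have <- := yS i j ivL jvL; rewrite [RHS]big_setU1//=.
  have vj : v == j = false by apply: contraNF vL => /eqP ->.
  have vyj : \sum_(k in vset L) y v k * s k j = - (y v v * s v j).
    rewrite (sum_subset NL) => [|k kL kN]; last by rewrite yN// mul0r.
    by apply/eqP; rewrite -addr_eq0 addrC vyS// vj.
  transitivity (\sum_(k in vset L) y i k * s k j -
                y i v / y v v * \sum_(k in vset L) y v k * s k j).
    rewrite mulr_sumr -sumrB; apply: eq_bigr => k _; rewrite mxE; field.
    by rewrite gt_eqF.
  by rewrite vyj; field; rewrite gt_eqF.
congr (_ * _); rewrite powRN -powR_inv1 ?powR_ge0// -powRrM mulrC powRrM.
congr (_ `^ _); rewrite powR_inv1 ?(ltW yv)//.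
(* By row v of y s = 1, this [c] solves s_N c = s_Nv, and the entry of y s at (v, v) then gives the
   ratio 1 / y_vv. *)
pose c j := - (y v j / y v v).
have dN : 0 < \det (restr s N).
  apply: posdef_on_det => //; apply: posdef_onS ps.
  by apply: (fintype.subset_trans NL); exact: finset.subsetUr.
rewrite /ratio (@det_restr_setU1 _ _ N s v c)// => [|i iN]; last first.
  have iL := fintype.subsetP NL i iN.
  have ivL : i \in v |: vset L by rewrite in_setU1 iL orbT.
  have := vyS i ivL; have -> : v == i = false by apply: contraNF vN => /eqP ->.
  move/eqP; rewrite addr_eq0 => /eqP vyi.
  apply: (mulfI (lt0r_neq0 yv)); rewrite (sE i v) vyi mulr_sumr -sumrN.
  apply: eq_bigr => k _; rewrite /c (sE i k); field.
  by rewrite gt_eqF.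
rewrite mulrC mulKf ?gt_eqF//.
have vyv : y v v * s v v + \sum_(k in N) y v k * s k v = 1.
  by rewrite vyS ?eqxx ?finset.setU11.
apply: (mulfI (lt0r_neq0 yv)); rewrite divff ?gt_eqF// -[LHS]vyv mulrBr;
  congr (_ + _).
rewrite mulr_sumr -sumrN; apply: eq_bigr => k _; rewrite /c (sE v k); field.
by rewrite gt_eqF.
Qed.

End perfect_elimination.

(** * Perfect orders of the cliques *)

Section perfect_orders.
Variables (r : nat) (e : rel 'I_r).
Implicit Types (P Q : seq {set 'I_r}) (A M : {set 'I_r}).

Lemma perfect_order_clique P j : perfect_order e P -> (j < size P)%N ->
  nth finset.set0 P j \in cliques e.
Proof.
by move=> /andP[PE _] jP; rewrite -mem_enum -(perm_mem PE) mem_nth.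
Qed.

Lemma clique_complete A : A \in cliques e -> complete e A.
Proof. by rewrite inE => /maxsetp. Qed.

Lemma complete_clique P M : perfect_order e P -> complete e M ->
  exists2 j, (j < size P)%N & M \subset nth finset.set0 P j.
Proof.
move=> /andP[PE _] cM; have [C mC MC] := maxset_exists cM.
have CP : C \in P by rewrite (perm_mem PE) mem_enum inE.
by exists (index C P); rewrite ?index_mem// nth_index.
Qed.

Lemma separator_sub P j : perfect_order e P -> (0 < j < size P)%N ->
  exists2 i, (i < j)%N & separator P j \subset nth finset.set0 P i.
Proof.
move=> /andP[_ /forallP PS] /andP[j0 jP].
have /implyP /(_ j0) /existsP[i /andP[ij Sj]] := PS (Ordinal jP).
by exists i.
Qed.

Lemma in_separator P j v : (v \in separator P j) =
  [exists i : 'I_j, v \in nth finset.set0 P i] && (v \in nth finset.set0 P j).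
Proof.
rewrite /separator inE; congr (_ && _); apply/bigcupP/existsP => -[i].
  by move=> _ vi; exists i.
by exists i.
Qed.

(** From left to right the perfect order enters: S_j lies in a single earlier clique. *)
Lemma subset_separator P A j : perfect_order e P -> (j < size P)%N ->
  (0 < j)%N && (A \subset separator P j) =
  (A \subset nth finset.set0 P j) && [exists i : 'I_j, A \subset nth finset.set0 P i].
Proof.
move=> pP jP; apply/idP/idP => [/andP[j0 /fintype.subsetP AS]|/andP[/fintype.subsetP Aj /existsP[i /fintype.subsetP Ai]]].
  apply/andP; split.
    by apply/fintype.subsetP => u /AS; rewrite in_separator => /andP[].
  have j0P : (0 < j < size P)%N by rewrite j0.
  have [i ij /fintype.subsetP Si] := separator_sub pP j0P.
  apply/existsP; exists (Ordinal ij); apply/fintype.subsetP => u uA.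
  by apply: Si; exact: AS.
rewrite (leq_trans _ (ltn_ord i))//; apply/fintype.subsetP => u uA.
by rewrite in_separator Aj// andbT; apply/existsP; exists i; exact: Ai.
Qed.

Lemma count_repeat (p : nat -> bool) n :
  (\sum_(0 <= j < n) (p j && [exists i : 'I_j, p i]) =
    (\sum_(0 <= j < n) p j).-1)%N.
Proof.
elim: n => [|n IH]; first by rewrite !big_geq.
rewrite !big_nat_recr//= IH; case: (p n) => /=; last by rewrite !addn0.
have -> : [exists i : 'I_n, p i] = (0 < \sum_(0 <= j < n) p j)%N.
  rewrite lt0n big_mkord sum_nat_eq0 negb_forall; apply: eq_existsb => i /=.
  by case: (p i).
by case: (\sum_(0 <= j < n) p j)%N => [|m]; rewrite ?addn0 ?addn1.
Qed.

(** [A] is contained in [S_j] if and only if it is contained in [C_j] and in an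
    earlier clique, so every clique containing [A] counts except the first. *)
Lemma count_separators P A : perfect_order e P ->
  count (fun S : {set 'I_r} => A \subset S) (separator_seq P) =
  (count (fun S : {set 'I_r} => A \subset S) P).-1.
Proof.
move=> pP; rewrite -[in RHS](mkseq_nth finset.set0 P) /mkseq /separator_seq !count_map.
have cE (a : pred nat) s : count a s = (\sum_(i <- s) a i)%N.
  by elim: s => [|i s IH]; rewrite ?big_nil ?big_cons //= IH.
rewrite !cE /= -[iota 0 _](congr1 (iota 0) (subn0 _)) -/(index_iota 0 _) -count_repeat.
rewrite -subn1 -/(index_iota 1 _).
case: (posnP (size P)) => [->|P0]; first by rewrite !big_geq.
rewrite [RHS]big_ltn//=.
have -> : [exists i : 'I_0, A \subset nth finset.set0 P i] = false.
  by apply/existsP => -[[]].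
rewrite andbF add0n; apply: eq_big_nat => j /andP[j0 jP].
by rewrite -subset_separator// j0.
Qed.

(** Moebius inversion, by descending induction on the cardinal of [A]. *)
Lemma eq_count_mem_sets (s1 s2 : seq {set 'I_r}) :
  (forall A, count (fun S : {set 'I_r} => A \subset S) s1 =
             count (fun S : {set 'I_r} => A \subset S) s2) ->
  forall A, count_mem A s1 = count_mem A s2.
Proof.
move=> s12 A; have [n An] : exists n, #|~: A| = n by exists #|~: A|.
have countE s B : count (fun S : {set 'I_r} => B \subset S) s =
    (\sum_(S : {set 'I_r} | B \subset S) count_mem S s)%N.
  elim: s => [|C s IH] /=; first by rewrite big1.
  rewrite big_split /= -IH; congr (_ + _)%N.
  rewrite [RHS]big_mkcond (bigD1 C)//= eqxx big1 => [|S SC]; last first.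
    by rewrite eq_sym (negPf SC) if_same.
  by rewrite addn0; case: (B \subset C).
elim/ltn_ind: n A An => n IH A An.
have := s12 A; rewrite !countE (bigD1 A)//= [in RHS](bigD1 A)//=.
rewrite [X in (_ + X)%N = _](_ : _ = \sum_(S : {set 'I_r} | (A \subset S) && (S != A)) count_mem S s2)%N.
  by move/eqP; rewrite eqn_add2r => /eqP.
apply: eq_bigr => S /andP[AS SA]; apply: (IH #|~: S|) => //.
rewrite -An; apply: proper_card; rewrite properE finset.setCS AS finset.setCS.
by apply: contra SA => SA; rewrite finset.eqEsubset SA.
Qed.

(** How many separators contain a given set depends only on the cliques, and inversion recovers the
    multiplicities. This lets [nu] and [separators] be computed from any given perfect order. *)
Lemma count_separator_seq P Q A : perfect_order e P -> perfect_order e Q ->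
  count_mem A (separator_seq P) = count_mem A (separator_seq Q).
Proof.
move=> pP pQ; apply: eq_count_mem_sets => {}A; rewrite !count_separators//.
have /andP[/permP PE _] := pP; have /andP[/permP QE _] := pQ.
by rewrite PE QE.
Qed.

Lemma some_perfect_orderP P : perfect_order e P ->
  perfect_order e (some_perfect_order e).
Proof.
move=> pP; rewrite /some_perfect_order; case: pickP => [//|/=].
have sP : size P == #|cliques e|.
  by have /andP[/perm_size -> _] := pP; rewrite -cardE.
by move=> /(_ (Tuple sP)); rewrite pP.
Qed.

Lemma nuE P A : perfect_order e P -> nu e A = count_mem A (separator_seq P).
Proof. by move=> pP; apply: count_separator_seq => //;
  exact: some_perfect_orderP pP. Qed.

Lemma separatorsE P : perfect_order e P -> separators e =
  [set S in separator_seq P].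
Proof.
move=> pP; apply/setP => S; rewrite !inE -!has_pred1 !has_count.
by rewrite (@count_separator_seq _ P) //; exact: some_perfect_orderP pP.
Qed.

(** Take the first clique C_m containing both u and b; as b is new in C_n, m >= n. If m > n, both
    lie in S_m, hence in a clique before C_m, against minimality. So the earlier neighbours of a new
    vertex lie in the clique that introduces it. *)
Lemma edge_in_clique P n u b : reflexive e -> symmetric e -> perfect_order e P ->
  (n < size P)%N ->
  b \in nth finset.set0 P n -> (forall i, (i < n)%N ->
    b \notin nth finset.set0 P i) ->
  (exists2 i, (i < n)%N & u \in nth finset.set0 P i) -> e u b ->
  u \in nth finset.set0 P n.
Proof.
move=> e_refl e_sym pP nP bn bP [i0 i0n ui0] eub.
pose ub : {set 'I_r} := [set u; b]%SET.
have cM : complete e ub.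
  apply/completeP => i j; rewrite !inE => /orP[]/eqP-> /orP[]/eqP->;
    rewrite ?e_refl//.
  by rewrite e_sym.
have exm : exists m, (m < size P)%N && (ub \subset nth finset.set0 P m).
  by have [m mP mS] := complete_clique pP cM; exists m; rewrite mP.
case: (ex_minnP exm) => m /andP[mP /fintype.subsetP mS] m_min.
have um : u \in nth finset.set0 P m by apply: mS; rewrite !inE eqxx.
have bm : b \in nth finset.set0 P m by apply: mS; rewrite !inE eqxx orbT.
have nm : (n <= m)%N by rewrite leqNgt; apply: contraL bm => /bP.
move: nm; rewrite leq_eqVlt => /orP[/eqP->//|nm].
have m0 : (0 < m < size P)%N by rewrite mP (leq_trans _ nm).
have [i im /fintype.subsetP Si] := separator_sub pP m0.
have := m_min i; rewrite (ltn_trans im mP) leqNgt im /= => /(_ _)/negP; case => //.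
apply/fintype.subsetP => w; rewrite !inE => /orP[]/eqP->; apply: Si;
  rewrite in_separator.
  rewrite um andbT; apply/existsP; exists (Ordinal (ltn_trans i0n nm)) => //.
by rewrite bm andbT; apply/existsP; exists (Ordinal nm).
Qed.

End perfect_orders.

(** * The elimination list of a perfect order *)

Section elimination_of_perfect_order.
Variables (R : realType) (r : nat) (e : rel 'I_r).
Hypotheses (e_refl : reflexive e) (e_sym : symmetric e).
Notation entry := ('I_r * {set 'I_r} * R)%type.
Implicit Types (M S T : {set 'I_r}) (L : seq entry) (a : R).

(** Each vertex of [s] gets as neighbours S and the vertices of [s] before it; the last one ends up
    at the head of the list. *)
Fixpoint chain S (s : seq 'I_r) a L : seq entry :=
  if s is b :: s' then chain (b |: S) s' a ((b, S, a) :: L) else L.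

Lemma vset_chain S s a L : vset (chain S s a L) = [set i in s] :|: vset L.
Proof.
elim: s S L => [|b s IH] S L /=; first by rewrite finset.set_nil finset.set0U.
by rewrite IH vset_cons set_cons finset.setUCA finset.setUA.
Qed.

Lemma completeS M T : M \subset T -> complete e T -> complete e M.
Proof.
move=> /fintype.subsetP MT /completeP cT; apply/completeP => i j iM jM.
by apply: cT; exact: MT.
Qed.

Lemma setU_setD M S : S \subset M -> S :|: (M :\: S) = M.
Proof. by move=> SM; rewrite -[RHS](finset.setID M S) (finset.setIidPr SM). Qed.

(** The largest neighbour set, that of the last vertex, has |S| + size s - 1 elements, whence the
    bound on [a]. It becomes (2) for a clique block, where |S| + size s = c_j, and (3) for S_2. *)
Lemma elimination_chain S s a L : elimination e L -> S \subset vset L -> uniq s ->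
  {in s, forall b, b \notin vset L} -> complete e (S :|: [set i in s]) ->
  {in s, forall b u, u \in vset L -> e u b -> u \in S} ->
  ((#|S| + size s)%:R - 1) / 2 < a -> elimination e (chain S s a L).
Proof.
elim: s S L => [//|b s IH] S L eL SL /andP[bs us] sL cS sS aS.
have bL : b \notin vset L by apply: sL; exact: mem_head.
have bS : b \notin S by apply: contra bL => /(fintype.subsetP SL).
have setE : b |: S :|: [set i in s] = S :|: [set i in b :: s].
  by rewrite set_cons finset.setUA (finset.setUC _ S).
apply: IH => //.
- split=> //.
  + apply/setP => u; rewrite inE; apply/idP/andP => [uS|[uL]].
      split; first exact: (fintype.subsetP SL).
      by move/completeP: cS; apply; rewrite !inE ?uS// eqxx orbT.
    by apply: sS => //; exact: mem_head.
  + by apply: completeS cS; exact: finset.subsetUl.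
  + apply: le_lt_trans aS; rewrite ler_pM2r ?invr_gt0// /= lerBrDr natr1 ler_nat.
    by rewrite addnS ltnS leq_addr.
- by rewrite vset_cons finset.setUS.
- move=> i si; rewrite vset_cons in_setU1 negb_or sL ?in_cons ?si ?orbT// andbT.
  by apply: contraNneq bs => <-.
- by rewrite setE.
- move=> i si u; rewrite vset_cons !in_setU1 => /orP[->//|uL] eui.
  by rewrite (sS i) ?orbT// in_cons si orbT.
- by rewrite cardsU1 bS add1n addSn -addnS.
Qed.

(** Inside T, a vertex with exponent [a] contributes a quotient of consecutive values of G, so a
    chain contributes only its two ends. One notion serves the Gamma factors, the powers of the
    ratios and the densities. *)
Definition telescopes (F : entry -> R) (G : {set 'I_r} -> R) a T :=
  (forall M b, b \notin M -> b |: M \subset T -> F (b, M, a) = G (b |: M) / G M) /\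
  (forall M, M \subset T -> G M != 0).

Lemma prod_chain F G a T S s L : telescopes F G a T ->
  S :|: [set i in s] \subset T ->
  uniq s -> {in s, forall b, b \notin S} ->
  \prod_(t <- chain S s a L) F t =
  G (S :|: [set i in s]) / G S * \prod_(t <- L) F t.
Proof.
move=> [FG G0]; elim: s S L => [|b s IH] S L ST.
  move: ST; rewrite finset.set_nil finset.setU0 => ST _ _ /=.
  by rewrite divff ?mul1r// G0.
move=> /andP[bs us] sS; have bS : b \notin S by apply: sS; exact: mem_head.
have setE : b |: S :|: [set i in s] = S :|: [set i in b :: s].
  by rewrite set_cons finset.setUA (finset.setUC _ S).
have bST : b |: S \subset T.
  by apply: fintype.subset_trans ST; rewrite -setE finset.subsetUl.
have ST' : S \subset T by apply: fintype.subset_trans bST; exact: finset.subsetUr.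
rewrite /= IH ?setE//; last first.
  move=> i si; rewrite in_setU1 negb_or sS ?in_cons ?si ?orbT// andbT.
  by apply: contraNneq bs => <-.
rewrite big_cons FG//; field.
by rewrite !G0.
Qed.

Variables (P : seq {set 'I_r}).
Hypothesis pP : perfect_order e P.
Local Notation C q := (nth finset.set0 P q).
Local Notation Sep q := (separator P q).

Lemma separator_subr q : Sep q \subset C q.
Proof. exact: finset.subsetIr. Qed.

Lemma separator1_sub : Sep 1 \subset C 0.
Proof. by rewrite /separator big_ord1 finset.subsetIl. Qed.

Section blocks.
Variables (alpha : {set 'I_r} -> R) (a0 : R).

Fixpoint blocks n : seq entry :=
  if n is n'.+1 then chain (Sep n) (enum (C n :\: Sep n)) (alpha (C n)) (blocks n')
  else chain (Sep 1) (enum (C 0 :\: Sep 1)) (alpha (C 0))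
         (chain finset.set0 (enum (Sep 1)) a0 [::]).

Lemma vset_nil : vset ([::] : seq entry) = finset.set0.
Proof. by apply/setP => i; rewrite !inE. Qed.

Lemma vset_blocks n : vset (blocks n) = (\bigcup_(i < n.+1) C i)%SET.
Proof.
elim: n => [|n IH] /=; rewrite !vset_chain !set_enum ?vset_nil ?finset.setU0.
  by rewrite big_ord1 finset.setUC setU_setD// separator1_sub.
rewrite IH [RHS]big_ord_recr /= finset.setUC; apply/setP => u.
rewrite finset.in_setU finset.in_setD in_separator finset.in_setU.
have [uC|uC] := boolP (u \in (\bigcup_(i < n.+1) C i)%SET);
  first by rewrite /= ?orbT.
have -> : [exists i : 'I_n.+1, u \in C i] = false.
  apply: contraNF uC => /existsP[i ui]; apply/bigcupP.
  by exists i.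
by case: (u \in C n.+1).
Qed.

Lemma elimination_blocks n : (n < size P)%N ->
  (forall q, (q < size P)%N -> (#|C q|%:R - 1) / 2 < alpha (C q)) ->
  (#|Sep 1|%:R - 1) / 2 < a0 -> elimination e (blocks n).
Proof.
move=> nP aC aS.
have cC q : (q < size P)%N -> complete e (C q).
  by move=> qP; apply: clique_complete; exact: perfect_order_clique.
have P0 : (0 < size P)%N by rewrite (leq_ltn_trans _ nP).
elim: n nP => [|n IH] nP /=.
  have v0 : vset (chain finset.set0 (enum (Sep 1)) a0 [::]) = Sep 1.
    by rewrite vset_chain set_enum vset_nil finset.setU0.
  apply: elimination_chain => //.
  - apply: elimination_chain => //.
    + exact: enum_uniq.
    + by move=> b _; rewrite vset_nil inE.
    + by rewrite finset.set0U set_enum; apply: completeS (cC 0%N P0);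
      exact: separator1_sub.
    + by rewrite cards0 add0n -cardE.
  - by rewrite v0.
  - exact: enum_uniq.
  - by move=> b; rewrite v0 mem_enum inE => /andP[].
  - rewrite set_enum setU_setD ?separator1_sub//.
    exact: cC.
  - by move=> b _ u; rewrite v0.
  - rewrite -cardE cardsD (finset.setIidPr separator1_sub) subnKC ?subset_leq_card ?separator1_sub//.
    exact: aC.
have nP' := ltnW nP.
have sepE u : u \in C n.+1 -> (u \in vset (blocks n)) = (u \in Sep n.+1).
  move=> uC; rewrite vset_blocks in_separator uC andbT.
  by apply/bigcupP/existsP => -[i]; [move=> _ ui; exists i|move=> ui; exists i].
apply: elimination_chain => //.
- exact: IH.
- by apply/fintype.subsetP => u uS; rewrite sepE//
  (fintype.subsetP (separator_subr _)).
- exact: enum_uniq.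
- by move=> b; rewrite mem_enum inE => /andP[bS bC]; rewrite sepE.
- rewrite set_enum; apply: completeS (cC _ nP).
  by rewrite finset.subUset separator_subr finset.subsetDl.
- move=> b; rewrite mem_enum inE => /andP[bS bC] u uL eub.
  rewrite -sepE//.
  apply: (@edge_in_clique _ e P n.+1 u b) => //.
    move=> i iN; apply: contra bS => bi; rewrite in_separator bC andbT.
    by apply/existsP; exists (Ordinal iN).
  move: uL; rewrite vset_blocks => /bigcupP[i _ ui].
  by exists i.
- rewrite -cardE cardsD (finset.setIidPr (separator_subr _)).
  by rewrite subnKC ?subset_leq_card ?separator_subr//; exact: aC.
Qed.

(** The right-hand side has the shape of both [Gamma_I] and [HG_perfect_order], so the constant, the
    ratios and the densities are all instances. *)
Lemma prod_blocks F G n : (n < size P)%N -> telescopes F (G a0) a0 (Sep 1) ->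
  (forall q, (q < size P)%N -> telescopes F (G (alpha (C q))) (alpha (C q)) (C q)) ->
  G a0 finset.set0 = 1 ->
  \prod_(t <- blocks n) F t =
  G a0 (Sep 1) * (G (alpha (C 0)) (C 0) / G (alpha (C 0)) (Sep 1)) *
  \prod_(1 <= q < n.+1) (G (alpha (C q)) (C q) / G (alpha (C q)) (Sep q)).
Proof.
move=> nP FS FC G1.
have P0 : (0 < size P)%N by rewrite (leq_ltn_trans _ nP).
elim: n nP => [|n IH] nP.
  rewrite [blocks 0]/= (prod_chain _ (FC 0%N P0)) ?enum_uniq//; last 2 first.
  - by rewrite set_enum setU_setD// separator1_sub.
  - by move=> b; rewrite mem_enum inE => /andP[].
  rewrite (prod_chain _ FS) ?enum_uniq//; last 2 first.
  - by rewrite set_enum finset.set0U.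
  - by move=> b _; rewrite inE.
  rewrite !set_enum setU_setD ?separator1_sub// finset.set0U G1 big_nil divr1 mulr1.
  by rewrite big_geq// mulr1 mulrC.
rewrite (_ : blocks n.+1 =
  chain (Sep n.+1) (enum (C n.+1 :\: Sep n.+1)) (alpha (C n.+1)) (blocks n))//.
rewrite (prod_chain _ (FC _ nP)) ?enum_uniq//; last 2 first.
- by rewrite set_enum setU_setD// separator_subr.
- by move=> b; rewrite mem_enum inE => /andP[].
rewrite set_enum setU_setD ?separator_subr// IH; last exact: ltnW.
by rewrite [in RHS]big_nat_recr//= [LHS]mulrC -!mulrA.
Qed.

End blocks.

(** * [H_G] and [mu_G] along a perfect order *)

Section markov_ratio.
Variables (alpha beta : {set 'I_r} -> R) (x : 'M[R]_r).
Hypothesis x0 : forall M, complete e M -> 0 < \det (restr x M).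
Hypothesis P1 : (1 < size P)%N.
Local Notation det M := (\det (restr x M)).

Let sepP q : (1 <= q < size P)%N -> Sep q \in separators e.
Proof.
move=> /andP[q1 qP]; rewrite (separatorsE pP) inE; apply: map_f.
by rewrite mem_iota q1 add1n (ltn_predK qP).
Qed.

Let detS q : (q < size P)%N -> 0 < det (Sep q).
Proof.
move=> qP; apply/x0/(completeS (separator_subr q)).
exact/clique_complete/perfect_order_clique.
Qed.

Let detSep S : S \in separators e -> 0 < det S.
Proof.
rewrite (separatorsE pP) inE => /mapP[q]; rewrite mem_iota => /andP[q1].
by rewrite add1n (ltn_predK P1) => qP ->; exact: detS.
Qed.

Let prod_cliques (f : {set 'I_r} -> R) :
  \prod_(M in cliques e) f M = \prod_(0 <= q < size P) f (C q).
Proof.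
have /andP[PE _] := pP; rewrite -big_enum /= -(perm_big _ PE) /=.
by rewrite (big_nth finset.set0).
Qed.

Let powR_sumr (u : R) (I : Type) (s : seq I) (p : pred I) (f : I -> R) : 0 < u ->
  u `^ (\sum_(i <- s | p i) f i) = \prod_(i <- s | p i) u `^ f i.
Proof.
move=> u0; apply: (big_morph (fun a => u `^ a)); last exact: powRr0.
by move=> a b; rewrite powRD// (gt_eqF u0) implybT.
Qed.

Let prod_separators (f : nat -> R) :
  \prod_(1 <= q < size P) det (Sep q) `^ f q =
  \prod_(S in separators e) det S `^ (\sum_(1 <= q < size P | Sep q == S) f q).
Proof.
rewrite big_nat_cond (partition_big (separator P) (mem (separators e))) /=;
  last first.
  by move=> q; rewrite andbT; exact: sepP.
apply: eq_bigr => S Ssep; rewrite powR_sumr ?detSep// [RHS]big_nat_cond.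
apply: eq_big => [q|q /andP[_ /eqP->]//].
by rewrite andbT.
Qed.

(** By (1), a separator S other than S_2 carries the sum of the exponents of the cliques C_j with
    S_j = S. At S_2 the discrepancy is delta_2, which is moved to the leading factor. *)
Lemma HG_perfect_order :
  (forall S, S \in separators e -> S != Sep 1 ->
     sum_J alpha P S - (nu e S)%:R * beta S = 0) ->
  HG e alpha beta x =
  det (Sep 1) `^ (alpha (C 0) + delta2 e alpha beta P) *
  (det (C 0) `^ alpha (C 0) / det (Sep 1) `^ alpha (C 0)) *
  \prod_(1 <= q < size P) (det (C q) `^ alpha (C q) / det (Sep q) `^ alpha (C q)).
Proof.
move=> ab; rewrite /HG prod_cliques.
have S1 : Sep 1 \in separators e by apply: sepP; rewrite P1.
have d1 := detSep S1.
have d1' u : det (Sep 1) `^ u != 0 by rewrite gt_eqF// powR_gt0.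
have -> : \prod_(S in separators e) det S `^ ((nu e S)%:R * beta S) =
    det (Sep 1) `^ (- delta2 e alpha beta P) *
    \prod_(1 <= q < size P) det (Sep q) `^ alpha (C q).
  rewrite prod_separators (bigD1 (Sep 1))//= [in RHS](bigD1 (Sep 1))//= mulrA.
  congr (_ * _).
    rewrite -powRD; last by rewrite (gt_eqF d1) implybT.
    by congr (_ `^ _); rewrite /delta2 -/(sum_J alpha P (Sep 1)); ring.
  apply: eq_bigr => S /andP[Ssep S1']; congr (_ `^ _).
  by apply/esym/eqP; rewrite -subr_eq0; apply/eqP; exact: ab.
rewrite big_ltn ?(ltnW P1)// prodf_div powRN powRD;
  last by rewrite (gt_eqF d1) implybT.
have : \prod_(1 <= q < size P) det (Sep q) `^ alpha (C q) != 0.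
  rewrite gt_eqF// big_nat; apply: prodr_gt0 => q /andP[_ qP].
  by rewrite powR_gt0// detS.
by move=> dS; field; rewrite !d1' dS.
Qed.

Lemma muG_perfect_order :
  muG e x = \prod_(0 <= q < size P) det (C q) `^ (- (#|C q|%:R + 1) / 2) *
            \prod_(1 <= q < size P) det (Sep q) `^ ((#|Sep q|%:R + 1) / 2).
Proof.
rewrite /muG prod_cliques; congr (_ * _).
rewrite prod_separators; apply: eq_bigr => S Ssep; congr (_ `^ _).
rewrite (eq_bigr (fun=> (#|S|%:R + 1) / 2)) => [|q /eqP->//].
rewrite (nuE S pP) /separator_seq count_map big_const_seq iter_addr addr0.
by rewrite /index_iota subn1 -[RHS]mulr_natl -mulrA.
Qed.

End markov_ratio.

End elimination_of_perfect_order.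

(** * The integral over [Q_G] *)

Section coordinates.
Variables (R : realType) (r : nat) (e : rel 'I_r).
Hypotheses (e_refl : reflexive e) (e_sym : symmetric e).
Implicit Types (p : 'I_r * 'I_r) (s : seq ('I_r * 'I_r)).

(** [coords] holds increasing pairs, whereas [elim_coords] puts the eliminated vertex first; sorting
    reconciles them. *)
Definition sort_pair p : 'I_r * 'I_r := if (p.1 <= p.2)%N then p else (p.2, p.1).

Lemma sort_pair_swap i j : sort_pair (j, i) = sort_pair (i, j).
Proof.
rewrite /sort_pair /=; case: leqP => ij; case: leqP => // ji.
  by congr pair; apply/val_inj/eqP; rewrite eqn_leq ij ji.
by have := ltn_trans ij ji; rewrite ltnn.
Qed.

Lemma sort_pair_le p : ((sort_pair p).1 <= (sort_pair p).2)%N.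
Proof. by rewrite /sort_pair; case: (leqP p.1 p.2) => //= /ltnW. Qed.

Lemma sort_pair_id p : (p.1 <= p.2)%N -> sort_pair p = p.
Proof. by rewrite /sort_pair => ->. Qed.

Lemma updseq_nth (x : 'M[R]_r) s (t : seq R) i j : size t = size s ->
  {in s, forall p, (p.1 <= p.2)%N} ->
  updseq x s t i j =
  if sort_pair (i, j) \in s then nth 0 t (index (sort_pair (i, j)) s) else x i j.
Proof.
elim: s t => [|p s IH] [|u t] //= [ts] sle.
rewrite mxE in_cons.
have -> : ((i, j) == p) || ((j, i) == p) = (sort_pair (i, j) == p).
  apply/orP/eqP => [[/eqP pE|/eqP pE]|pE].
  - by rewrite pE sort_pair_id// sle// mem_head.
  - by rewrite -sort_pair_swap pE sort_pair_id// sle// mem_head.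
  - move: pE; rewrite /sort_pair; case: ifP => _ <- /=; rewrite eqxx; first by left.
    by right.
rewrite [p == _]eq_sym; case: eqVneq => //= _.
by apply: IH => // q qs; apply: sle; rewrite in_cons qs orbT.
Qed.

Lemma graphmx_of_updseq (t : #|coords e|.-tuple (measurableTypeR R)) :
  graphmx_of t = updseq (0 : 'M[R]_r) (enum (coords e)) t.
Proof.
apply/matrixP => i j; rewrite updseq_nth; last 2 first.
- by rewrite size_tuple cardE.
- by move=> p; rewrite mem_enum inE => /andP[].
by rewrite !mxE /sort_pair mem_enum.
Qed.

Lemma measurable_graphmx_of i j :
  measurable_fun [set: #|coords e|.-tuple (measurableTypeR R)]
    (fun t => graphmx_of t i j : R).
Proof.
under eq_fun do rewrite mxE -/(sort_pair (i, j)) /=.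
have [ijc|_] := boolP (sort_pair (i, j) \in coords e); last exact: measurable_cst.
have ijlt : (index (sort_pair (i, j)) (enum (coords e)) < #|coords e|)%N.
  by rewrite cardE index_mem mem_enum.
rewrite (_ : (fun _ => _) = fun t : #|coords e|.-tuple (measurableTypeR R) =>
  tnth t (Ordinal ijlt)); first exact: measurable_tnth.
by apply/funext => t; rewrite (tnth_nth 0).
Qed.

Lemma graphmx_of_graphmx (t : #|coords e|.-tuple (measurableTypeR R)) :
  graphmx e (graphmx_of t).
Proof.
split=> [|i j ij].
  by apply/matrixP => i j; rewrite !mxE -/(sort_pair (i, j)) -/(sort_pair (j, i)) sort_pair_swap.
rewrite mxE -/(sort_pair (i, j)) /= ifF// inE; apply/negP => /andP[_].
by apply/negP; rewrite /sort_pair; case: ifP => _ //=; rewrite e_sym.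
Qed.

Lemma mem_elim_coords (L : seq ('I_r * {set 'I_r} * R)) p : elimination e L ->
  (p \in map sort_pair (elim_coords L)) =
  [&& (p.1 <= p.2)%N, e p.1 p.2, p.1 \in vset L & p.2 \in vset L].
Proof.
elim: L => [|[[v N] a] L IH]; first by rewrite /= inE /vset /= !inE !andbF.
move=> [vL NE cN aN eL]; rewrite vset_cons.
rewrite (_ : elim_coords _ = ((v, v) :: [seq (v, n) | n <- enum N]) ++ elim_coords L)//.
rewrite map_cat mem_cat IH// => {IH}.
case: p => i j /=.
rewrite in_cons !in_setU1 (@sort_pair_id (v, v) (leqnn v)).
apply/idP/idP.
  case/orP => [/orP[/eqP[-> ->]|/mapP[q /mapP[n]]]|].
  - by rewrite leqnn e_refl eqxx.
  - rewrite mem_enum NE inE => /andP[nL env] -> ijE.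
    have [-> ->] : i = (sort_pair (v, n)).1 /\ j = (sort_pair (v, n)).2.
      by rewrite -ijE.
    rewrite sort_pair_le /=.
    rewrite /sort_pair; case: ifP => _ /=; rewrite eqxx nL ?orbT /= ?andbT //.
    by rewrite e_sym.
  - by case/and4P => -> -> -> ->; rewrite !orbT.
case/and4P => ij eij /orP[/eqP iv|iL] /orP[/eqP jv|jL].
- by rewrite iv jv eqxx.
- apply/orP; left; apply/orP; right; apply/mapP; exists (v, j).
    by apply/mapP; exists j => //; rewrite mem_enum NE inE jL e_sym -iv.
  by rewrite sort_pair_id -?iv.
- apply/orP; left; apply/orP; right; apply/mapP; exists (v, i).
    by apply/mapP; exists i => //; rewrite mem_enum NE inE iL -jv.
  by rewrite sort_pair_swap sort_pair_id -?jv.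
- by rewrite ij eij iL jL !orbT.
Qed.

Lemma uniq_elim_coords (L : seq ('I_r * {set 'I_r} * R)) : elimination e L ->
  uniq (map sort_pair (elim_coords L)).
Proof.
elim: L => [//|[[v N] a] L IH] [vL NE cN aN eL].
rewrite (_ : elim_coords _ = ((v, v) :: [seq (v, n) | n <- enum N]) ++ elim_coords L)//.
have vN : v \notin N by rewrite NE inE (negPf vL).
rewrite map_cat cat_uniq IH// andbT; apply/andP; split.
  have inj : injective (fun n => sort_pair (v, n)).
    move=> n m; rewrite /sort_pair /=; case: leqP => vn; case: leqP => vm [] //.
    + by move=> -> ->.
    + by move=> -> ->.
  rewrite map_inj_in_uniq.
    rewrite cons_uniq map_inj_uniq ?enum_uniq ?andbT; last by move=> n m [].
    by apply/mapP => -[n]; rewrite mem_enum => nN [vn]; rewrite vn nN in vN.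
  have mem q : q \in (v, v) :: [seq (v, n) | n <- enum N] -> exists n, q = (v, n).
    by rewrite in_cons => /orP[/eqP->|/mapP[n _ ->]]; [exists v|exists n].
  by move=> q1 q2 /mem[n ->] /mem[m ->] /inj ->.
apply/hasPn => p; rewrite mem_elim_coords// => /and4P[_ _ p1 p2].
apply/negP => /mapP[q] qs pq; move: p1 p2; rewrite pq.
have [n ->] : exists n, q = (v, n).
  by move: qs; rewrite in_cons => /orP[/eqP->|/mapP[n _ ->]]; [exists v|exists n].
by rewrite /sort_pair; case: ifP => _ /=; rewrite (negPf vL).
Qed.

(** Each edge is listed exactly once, at the endpoint that is eliminated first. *)
Lemma perm_elim_coords (L : seq ('I_r * {set 'I_r} * R)) : elimination e L ->
  vset L = finset.setT -> perm_eq (map sort_pair (elim_coords L)) (enum (coords e)).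
Proof.
move=> eL vL; apply: uniq_perm; [exact: uniq_elim_coords|exact: enum_uniq|].
by move=> p; rewrite mem_elim_coords// mem_enum vL !inE !andbT.
Qed.

(** The base point 0 supplies the entries outside E; Tonelli's theorem permits the change from the
    order of [enum] to the elimination order. *)
Lemma integral_graphmx_of (L : seq ('I_r * {set 'I_r} * R)) (f : 'M[R]_r ->
  \bar R) :
  elimination e L -> vset L = finset.setT ->
  (forall x, 0 <= f x)%E -> measurable_mxfun f ->
  (\int[lebesgue_tuple R #|coords e|]_t f (graphmx_of t) =
    iint (elim_coords L) f 0)%E.
Proof.
move=> eL vL f0 mf; under eq_integral do rewrite graphmx_of_updseq.
rewrite -iint_lebesgue_tuple//; last by rewrite -cardE.
rewrite -(iint_perm (perm_elim_coords eL vL))//.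
rewrite -(iint_map_swap (fun p => (p.1 <= p.2)%N) (elim_coords L)).
by [].
Qed.

End coordinates.

(** * Telescoping of Gamma factors, ratios and densities *)

Section telescoping_products.
Variables (R : realType) (r : nat) (e : rel 'I_r).
Implicit Types (M T : {set 'I_r}) (a : R) (x : 'M[R]_r).

Lemma powR_div (u w a : R) : 0 < u -> 0 < w -> (u / w) `^ a = u `^ a / w `^ a.
Proof.
move=> u0 w0; rewrite powRM ?invr_ge0 ?ltW//; congr (_ * _).
by rewrite -(powR_inv1 (ltW w0)) -powRrM mulN1r powRN.
Qed.

(** The new factor is the constant contributed by a vertex with n neighbours. *)
Lemma Gamma_mvS n (p : R) :
  Gamma_mv n.+1 p = Gamma_mv n p * (pi `^ (n%:R / 2) * Gamma (p - n%:R / 2)).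
Proof.
rewrite /Gamma_mv big_ord_recr /= [RHS]mulrACA; congr (_ * _).
rewrite -powRD; last by rewrite (gt_eqF (pi_gt0 R)) implybT.
by congr (_ `^ _); rewrite -natr1; field.
Qed.

Lemma Gamma_mv_gt0 n (p : R) : (n%:R - 1) / 2 < p -> 0 < Gamma_mv n p.
Proof.
move=> np; rewrite mulr_gt0 ?powR_gt0 ?pi_gt0//; apply: prodr_gt0 => j _.
apply: Gamma_gt0; rewrite subr_gt0; apply: le_lt_trans np.
by rewrite ler_pM2r ?invr_gt0// lerBrDr natr1 ler_nat.
Qed.

Lemma telescopes_Gamma a T : (#|T|%:R - 1) / 2 < a ->
  telescopes (fun t => pi `^ (#|t.1.2|%:R / 2) * Gamma (t.2 - #|t.1.2|%:R / 2))
    (fun M => Gamma_mv #|M| a) a T.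
Proof.
move=> aT.
have G0 M : M \subset T -> Gamma_mv #|M| a != 0.
  move=> MT; rewrite gt_eqF// Gamma_mv_gt0//; apply: le_lt_trans aT.
  by rewrite ler_pM2r ?invr_gt0// lerD2r ler_nat subset_leq_card.
split=> // M b bM bMT; rewrite cardsU1 bM add1n Gamma_mvS [X in _ =
  X / _]mulrC mulfK// G0//.
by apply: fintype.subset_trans bMT; exact: finset.subsetUr.
Qed.

Lemma telescopes_ratio a T x :
  (forall M, complete e M -> 0 < \det (restr x M)) -> complete e T ->
  telescopes (fun t => ratio t.1.1 t.1.2 x `^ t.2)
    (fun M => \det (restr x M) `^ a) a T.
Proof.
move=> x0 cT; have dT M : M \subset T -> 0 < \det (restr x M).
  by move=> MT; apply: x0; exact: completeS cT.
split=> [M b bM bMT /=|M MT]; last by rewrite gt_eqF// powR_gt0// dT.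
rewrite /ratio powR_div ?dT//; apply: fintype.subset_trans bMT.
exact: finset.subsetUr.
Qed.

Lemma telescopes_dens a T x :
  (forall M, complete e M -> 0 < \det (restr x M)) -> complete e T ->
  telescopes (fun t => dens t x)
    (fun M => \det (restr x M) `^ a * \det (restr x M) `^ (- (#|M|%:R +
      1) / 2)) a T.
Proof.
move=> x0 cT; have dT M : M \subset T -> 0 < \det (restr x M).
  by move=> MT; apply: x0; exact: completeS cT.
split=> [M b bM bMT /=|M MT]; last by rewrite gt_eqF// mulr_gt0// powR_gt0// dT.
have dM : 0 < \det (restr x M).
  by apply: dT; apply: fintype.subset_trans bMT; exact: finset.subsetUr.
have dbM := dT _ bMT.
rewrite divr_gt0// /ratio powR_div//.
have -> : - (#|b |: M|%:R + 1) / 2 = - (#|M|%:R + 2) / 2 :> R.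
  by rewrite cardsU1 bM add1n -natr1; field.
rewrite (_ : (#|M|%:R + 1) / 2 = - (- (#|M|%:R + 1) / 2)); last by field.
rewrite powRN; field.
by rewrite !gt_eqF// powR_gt0.
Qed.

End telescoping_products.

(** * The integral formula for a perfect order *)

Section main.
Variables (R : realType) (r : nat) (e : rel 'I_r).
Hypotheses (e_refl : reflexive e) (e_sym : symmetric e).
Hypothesis e_noncomplete : exists i j, ~~ e i j.
Variables (P : seq {set 'I_r}).
Hypothesis pP : perfect_order e P.
Variables (alpha beta : {set 'I_r} -> R).
Hypothesis abP : A_P e P (alpha, beta).
Implicit Types (x y : 'M[R]_r).
Local Notation C q := (nth finset.set0 P q).
Local Notation Sep q := (separator P q).

(** Singletons are complete, so with a single clique every vertex would lie in it and the graph
    would be complete. Hence S_2 exists. *)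
Let P1 : (1 < size P)%N.
Proof.
rewrite ltnNge; apply/negP => P1; case: e_noncomplete => i [j /negP]; apply.
have in0 k : k \in C 0.
  have ck : complete e [set k]%SET.
    by apply/completeP => a b; rewrite !inE => /eqP -> /eqP ->.
  have [q qP] := complete_clique pP ck; rewrite finset.sub1set.
  by have -> : q = 0%N by apply/eqP; rewrite -leqn0 -ltnS (leq_trans qP).
have P0 : (0 < size P)%N.
  rewrite lt0n size_eq0; apply/eqP => P0.
  by have := in0 i; rewrite P0 nth_nil inE.
by move/completeP: (clique_complete (perfect_order_clique pP P0)); apply.
Qed.

Let a0 := alpha (C 0) + delta2 e alpha beta P.
Let L := blocks P alpha a0 (size P).-1.

Let k1P : ((size P).-1 < size P)%N.
Proof. by rewrite prednK// ltnW. Qed.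

Let alphaC q : (q < size P)%N -> (#|C q|%:R - 1) / 2 < alpha (C q).
Proof.
by case: abP => _ aC _ qP; have := aC (C q) (mem_nth _ qP); rewrite subr_gt0.
Qed.

Let a0S : (#|Sep 1|%:R - 1) / 2 < a0.
Proof. by case: abP. Qed.

Let eL : elimination e L.
Proof. exact: elimination_blocks. Qed.

Let vL : vset L = finset.setT.
Proof.
rewrite vset_blocks; apply/setP => k; rewrite inE; apply/bigcupP.
have ck : complete e [set k]%SET.
  by apply/completeP => a b; rewrite !inE => /eqP -> /eqP ->.
have [q qP] := complete_clique pP ck; rewrite finset.sub1set => kq.
have qP' : (q < (size P).-1.+1)%N by rewrite prednK// ltnW.
by exists (Ordinal qP').
Qed.

Let cC q : (q < size P)%N -> complete e (C q).
Proof. by move=> qP; exact/clique_complete/perfect_order_clique. Qed.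

Let cS1 : complete e (Sep 1).
Proof. by apply: completeS (cC (ltnW P1)); exact: separator1_sub. Qed.

Let detG x : (forall M, complete e M -> posdef_on M x) -> x^T = x ->
  forall M, complete e M -> 0 < \det (restr x M).
Proof. by move=> px xs M cM; apply: posdef_on_det => //; exact: px. Qed.

Let size_predK : (size P).-1.+1 = size P.
Proof. by rewrite prednK// ltnW. Qed.

Let prod_Gamma : \prod_(t <- L) (pi `^ (#|t.1.2|%:R / 2) * Gamma (t.2 - #|t.1.2|%:R / 2)) =
  Gamma_I e alpha beta P.
Proof.
rewrite (prod_blocks (G := fun a M => Gamma_mv #|M| a) k1P)//; last 3 first.
- exact: telescopes_Gamma.
- by move=> q qP; apply: telescopes_Gamma; exact: alphaC.
- by rewrite /Gamma_mv cards0 !mul0r powRr0 big_ord0 mulr1.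
by rewrite size_predK.
Qed.

Let prod_ratio x : (forall M, complete e M -> 0 < \det (restr x M)) ->
  \prod_(t <- L) ratio t.1.1 t.1.2 x `^ t.2 = HG e alpha beta x.
Proof.
move=> x0; rewrite (HG_perfect_order pP x0 P1); last by case: abP.
rewrite (prod_blocks (G := fun a M => \det (restr x M) `^ a) k1P)//; last 3 first.
- exact: (@telescopes_ratio _ _ e a0 (Sep 1) x x0 cS1).
- by move=> q qP; exact: (@telescopes_ratio _ _ e _ _ x x0 (cC qP)).
- by rewrite det_restr0 powR1.
by rewrite size_predK.
Qed.

Let prod_dens x : (forall M, complete e M -> 0 < \det (restr x M)) ->
  \prod_(t <- L) dens t x = HG e alpha beta x * muG e x.
Proof.
move=> x0; rewrite (HG_perfect_order pP x0 P1); last by case: abP.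
rewrite (muG_perfect_order pP x0 P1).
pose m M := \det (restr x M) `^ (- (#|M|%:R + 1) / 2).
rewrite (prod_blocks (G := fun a M => \det (restr x M) `^ a * m M) k1P)//;
  last 3 first.
- exact: (@telescopes_dens _ _ e a0 (Sep 1) x x0 cS1).
- by move=> q qP; exact: (@telescopes_dens _ _ e _ _ x x0 (cC qP)).
- by rewrite /m det_restr0 !powR1 mulr1.
rewrite size_predK (@big_ltn _ _ _ 0) ?(ltnW P1)//=.
have S1C q : (q < size P)%N -> 0 < \det (restr x (Sep q)).
  by move=> qP; apply/x0/(completeS (separator_subr P q))/cC.
have -> : \prod_(1 <= q < size P) \det (restr x (Sep q)) `^ ((#|Sep q|%:R +
  1) / 2) =
    (\prod_(1 <= q < size P) m (Sep q))^-1.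
  rewrite -prodfV; apply: eq_bigr => q _; rewrite /m.
  by rewrite (_ : - (_ + 1) / 2 = - ((#|Sep q|%:R + 1) / 2)) ?powRN ?invrK//; field.
have m0 q : (q < size P)%N -> m (Sep q) != 0.
  by move=> qP; rewrite gt_eqF// powR_gt0// S1C.
have -> : \prod_(1 <= q < size P) (\det (restr x (C q)) `^ alpha (C q) * m (C q) /
      (\det (restr x (Sep q)) `^ alpha (C q) * m (Sep q))) =
    \prod_(1 <= q < size P) (\det (restr x (C q)) `^ alpha (C q) /
      \det (restr x (Sep q)) `^ alpha (C q)) *
    (\prod_(1 <= q < size P) m (C q) / \prod_(1 <= q < size P) m (Sep q)).
  rewrite -prodf_div -big_split /= big_nat [RHS]big_nat;
    apply: eq_bigr => q /andP[_ qP].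
  by rewrite invfM; ring.
have := m0 1%N P1; rewrite -/(m _).
have p0 : \prod_(1 <= q < size P) m (Sep q) != 0.
  by rewrite prodf_seq_neq0; apply/allP => q;
    rewrite mem_index_iota => /andP[_ qP]; apply/implyP => _; exact: m0.
have d0 : \det (restr x (Sep 1)) `^ alpha (C 0) != 0 by rewrite gt_eqF//
  powR_gt0// S1C.
by rewrite -/(m (C 0)) => mS; field; rewrite d0 mS p0.
Qed.

Let posdef_onQG x : graphmx e x -> QG e x <-> (forall M, complete e M ->
  posdef_on M x).
Proof.
move=> gx; have [xs _] := gx; split=> [[_ px] M cM|px].
  have [q qP MC] := complete_clique pP cM.
  apply: (posdef_onS MC); apply/(posdef_onP _ xs); apply: px.
  exact: perfect_order_clique.
by split=> // M MC; apply/(posdef_onP _ xs)/px; exact: clique_complete.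
Qed.

Let measurable_integrand y : measurable_mxfun (integrand e alpha beta y).
Proof.
have mp (f : {set 'I_r} -> R) (A : {set {set 'I_r}}) : measurable_mxfun
    (fun x => \prod_(M in A) \det (restr x M) `^ f M : R).
  apply: measurable_mxfun_prod => M.
  apply: (measurable_mxfun_comp (h := fun u => u `^ f M)) => //.
  exact: measurable_mxfun_det_restr.
apply: measurable_mxfunM; last by apply: measurable_mxfunM; exact: mp.
apply: measurable_mxfunM; last first.
  apply: measurable_mxfunM; first exact: mp.
  apply: (measurable_mxfun_comp (h := fun u => u^-1)); last exact: mp.
  exact: measurable_invr.
apply: measurable_mxfun_comp => //; apply: measurable_mxfunN.
apply: measurable_mxfun_sum => i; apply: measurable_mxfun_sum => j.
by apply: measurable_mxfunM; [exact: measurable_mxfun_entry|exact: measurable_mxfun_cst].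
Qed.

Let integrand_ge0 y x : 0 <= integrand e alpha beta y x.
Proof.
have pr (f : {set 'I_r} -> R) (A : {set {set 'I_r}}) :
    0 <= \prod_(M in A) \det (restr x M) `^ f M.
  by apply: prodr_ge0 => M _; exact: powR_ge0.
by rewrite !mulr_ge0 ?expR_ge0 ?invr_ge0 ?pr.
Qed.

Let posdef_on_setT y : posdefmx y -> posdef_on finset.setT y.
Proof.
move=> [_ py] u [i _ ui].
have := py (\col_k u k); rewrite mxE.
have -> : \sum_j ((\col_k u k)^T *m y) ord0 j * (\col_k u k) j ord0 =
    quad finset.setT y u.
  rewrite /quad exchange_big /=; apply: eq_big => [j|j _]; first by rewrite inE.
  rewrite !mxE mulr_suml; apply: eq_big => [k|k _]; first by rewrite inE.
  by rewrite !mxE.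
apply; apply/eqP => /matrixP /(_ i ord0); rewrite !mxE => u0.
by rewrite u0 eqxx in ui.
Qed.

(** On a complete set [phi e y] agrees with y^-1, and a ratio involves only the complete set v |: N;
    so the ratios of y^-1 found in [elim_powE] are those of [phi e y]. *)
Let phi_facts y : PG e y ->
  (forall M, complete e M -> 0 < \det (restr (phi e y) M)) /\
  elim_pow L y = HG e alpha beta (phi e y).
Proof.
move=> [[ys y0] py]; have pT := posdef_on_setT py.
have [B [Bs pB yB _]] := posdef_on_inv ys pT.
have yBE : y *m B = 1%:M.
  apply/matrixP => i j; rewrite !mxE -yB ?inE//.
  by apply: eq_big => // k; rewrite inE.
have yu : y \in unitmx by case/mulmx1_unit: yBE.
have BE : B = invmx y.
  by rewrite -[B]mul1mx -(mulVmx yu) -mulmxA yBE mulmx1.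
have rE M : complete e M -> restr (phi e y) M = restr B M.
  move=> /completeP cM; apply: eq_restr => i j iM jM.
  by rewrite mxE cM// BE.
have phi0 M : complete e M -> 0 < \det (restr (phi e y) M).
  move=> cM; rewrite rE//; apply: posdef_on_det => //.
  by apply: posdef_onS pB; exact: finset.subsetT.
split=> //; rewrite (@elim_powE _ _ e e_sym L y B)// ?vL//; last first.
  by move=> i j _ _; exact: y0.
rewrite -prod_ratio// big_seq [RHS]big_seq; apply: eq_bigr => t tL.
congr (_ `^ _); rewrite /ratio.
have cvN := elimination_complete e_refl e_sym eL tL.
rewrite !rE//; apply: completeS cvN; exact: finset.subsetUr.
Qed.

Lemma integral_integrand y : PG e y ->
  (\int[lebesgue_tuple R #|coords e|]_(t in @QG_coords R r e)
     (integrand e alpha beta y (graphmx_of t))%:E =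
   (Gamma_I e alpha beta P * HG e alpha beta (phi e y))%:E)%E.
Proof.
move=> Py; have [[ys y0] py] := Py.
have [_ <-] := phi_facts Py; rewrite -prod_Gamma.
rewrite -(iint_elimination e_sym eL ys (x := 0)) ?vL ?trmx0//; last 2 first.
- exact: posdef_on_setT.
- by move=> i j _ _; exact: y0.
rewrite -(integral_graphmx_of e_refl e_sym eL vL); last 2 first.
- by move=> x; rewrite lee_fin mulr_ge0 ?expR_ge0 ?prod_dens_ge0.
- exact: measurable_elim_integrand.
rewrite integral_mkcond; apply: eq_integral => t _; rewrite patchE.
set x := graphmx_of t.
have gx : graphmx e x := graphmx_of_graphmx e_sym t.
have [xs _] := gx.
case: ifPn => [|tQ].
  rewrite inE => /(posdef_onQG gx) px; congr EFin.
  rewrite (prod_dens (detG px xs)) /integrand -mulrA; congr (expR (- _) * _).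
  rewrite /pairing /pair_on; apply: eq_big => [i|i _]; first by rewrite inE.
  rewrite big_mkcond [RHS]big_mkcond; apply: eq_bigr => j _; rewrite inE.
  by case: ifPn => // ij; rewrite y0// mulr0.
(* Outside [Q_G] some ratio is not positive, as otherwise every complete block would be positive
   definite; the corresponding density is 0. *)
rewrite (_ : \prod_(t <- L) dens t x = 0) ?mulr0//.
apply/eqP; rewrite -[_ == 0]negbK; apply: contra tQ => dens0; rewrite inE.
apply/(posdef_onQG gx) => M cM.
apply: (posdef_on_elimination eL xs) => //; last by rewrite vL finset.subsetT.
move=> s sL; rewrite ltNge; apply: contra dens0 => s0.
rewrite prodf_seq_eq0; apply/hasP; exists s => //=.
by case: s s0 {sL} => -[v N] a /= s0; rewrite ltNge s0.
Qed.

(** Integrability follows from the finite value, the integrand being nonnegative; the last conjunct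
    permits the division in [calA]. *)
Lemma integral_PG y : PG e y ->
  [/\ QG_integrable e (integrand e alpha beta y),
      IG e alpha beta y = Gamma_I e alpha beta P * HG e alpha beta (phi e y) &
      HG e alpha beta (phi e y) != 0].
Proof.
move=> Py; split.
- apply/integrableP; split.
    apply: measurable_funTS; apply/measurable_EFinP.
    apply: measurable_integrand => i j.
    exact: measurable_graphmx_of.
  under eq_integral do rewrite gee0_abs ?lee_fin//.
  by rewrite integral_integrand// ltry.
- by rewrite /IG /int_QG /Rintegral integral_integrand.
- have [phi0 _] := phi_facts Py; rewrite -prod_ratio// prodf_seq_neq0.
  apply/allP => t tL; apply/implyP => _; rewrite gt_eqF// powR_gt0//.
  have cvN := elimination_complete e_refl e_sym eL tL.
  by rewrite divr_gt0// phi0//; apply: completeS cvN; exact: finset.subsetUr.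
Qed.

End main.

Theorem theorem3p3 (R : realType) (r : nat) (e : rel 'I_r)
    (e_refl : reflexive e) (e_sym : symmetric e)
    (e_dec : decomposable e) (e_noncomplete : exists i j, ~~ e i j)
    (P : seq {set 'I_r}) (P_perfect : perfect_order e P) :
  @A_P R r e P `<=` @calA R r e /\
  (forall (alpha beta : {set 'I_r} -> R) (y : 'M[R]_r),
     A_P e P (alpha, beta) -> PG e y ->
     QG_integrable e (integrand e alpha beta y) /\
     IG e alpha beta y =
       Gamma_I e alpha beta P * HG e alpha beta (phi e y)).
Proof.
have main := integral_PG e_refl e_sym e_noncomplete P_perfect.
split=> [[alpha beta] ab|alpha beta y ab Py];
  last by have [? ? _] := main _ _ _ ab _ Py.
split=> [y Py|]; first by have [] := main _ _ _ ab _ Py.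
exists (Gamma_I e alpha beta P) => y Py /=.
by have [_ -> H0] := main _ _ _ ab _ Py; rewrite mulfK.
Qed.
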